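(* Let $D=\{z\in\mathbb C : |z|\le 1\}$, let $p_1,p_2,p_3$ be three distinct points in the interior of $D$, and let $X\to D$ be the 3-fold branched covering of $D$ with branch points $p_1,p_2,p_3$ modeled on $y^3=(z-p_1)(z-p_2)(z-p_3)$. Then $X$ is a torus with three boundary components, i.e. a compact connected orientable surface of genus $1$ with exactly $3$ boundary circles.
   Context: For a finite set $P=\{p_1,\dots,p_k\}$ of distinct interior points of the closed unit disk $D\subset\mathbb C$, the 3-fold branched covering of $D$ with branch points $P$ means the cyclic branched covering $p:X\to D$ given by the part lying over $D$ of the Riemann surface of $f_P(z)=\bigl((z-p_1)\cdots(z-p_k)\bigr)^{1/3}$; explicitly $X=\{(z,y)\in D\times\mathbb C : y^3=(z-p_1)\cdots(z-p_k)\}$ with $p(z,y)=z$. *)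

(* Defs.v *)
From HB Require Import structures.
From mathcomp Require Import all_boot all_order all_algebra.
From mathcomp Require Import all_classical all_reals all_analysis.
From mathcomp Require Import complex.

Set Implicit Arguments.
Unset Strict Implicit.
Unset Printing Implicit Defensive.

Import Order.TTheory GRing.Theory Num.Theory numFieldNormedType.Exports.
Local Open Scope classical_set_scope.
Local Open Scope ring_scope.

(* The complex numbers over R with their metric topology: MathComp-Analysis
   attaches the norm topology of R[i] to the alias R[i]^o. *)
Notation Cplx R := ((R : realType)[i]^o)%type.

Definition disc (R : realType) : set (Cplx R) := [set z | `|z| <= 1].

Definition circle (R : realType) : set (Cplx R) := [set z | `|z| = 1].

Definition torus (R : realType) : set (Cplx R * Cplx R) :=
  [set w | circle w.1 /\ circle w.2].

Definition cyclic_cover3 (R : realType) (P : seq (Cplx R)) :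
    set (Cplx R * Cplx R) :=
  [set w | disc w.1 /\ w.2 ^+ 3 = \prod_(p <- P) (w.1 - p)].

(* Spaces are subsets of an ambient topological space, with the subspace
   topology.  Maps between them are restrictions of total functions whose values
   off the given subset are irrelevant. *)

Definition rel_open (T : topologicalType) (A U : set T) : Prop :=
  exists2 O : set T, open O & U = A `&` O.

Definition homeo_on (T U : topologicalType) (A : set T) (B : set U)
    (f : T -> U) (g : U -> T) : Prop :=
  [/\ {homo f : x / A x >-> B x}, {homo g : y / B y >-> A y},
      {in A, cancel f g}, {in B, cancel g f} &
      {within A, continuous f} /\ {within B, continuous g}].

Definition homeomorphic (T U : topologicalType) (A : set T) (B : set U) : Prop :=
  exists (f : T -> U) (g : U -> T), homeo_on A B f g.

Definition embedding_on (T U : topologicalType) (A : set T) (f : T -> U) : Prop :=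
  exists g : U -> T, homeo_on A (f @` A) f g.

Definition half_plane (R : realType) : set 'rV[R]_2 := [set v | 0 <= v 0 1].

Record chart (R : realType) (T : topologicalType) := Chart {
  chart_dom : set T;
  chart_img : set 'rV[R]_2;
  chart_map : T -> 'rV[R]_2;
  chart_inv : 'rV[R]_2 -> T }.

Definition chart_of (R : realType) (T : topologicalType) (A : set T)
    (c : chart R T) : Prop :=
  [/\ rel_open A (chart_dom c), rel_open (@half_plane R) (chart_img c) &
      homeo_on (chart_dom c) (chart_img c) (chart_map c) (chart_inv c)].

(* f is differentiable at w relatively to D, with positive Jacobian determinant;
   J acts on row vectors from the right. *)
Definition pos_jacobian_within (R : realType) (D : set 'rV[R]_2)
    (f : 'rV[R]_2 -> 'rV[R]_2) (w : 'rV[R]_2) : Prop :=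
  exists2 J : 'M[R]_2, 0 < \det J &
    forall eps : R, 0 < eps ->
      \forall v \near within D (nbhs w),
        `|f v - f w - (v - w) *m J| <= eps * `|v - w|.

Definition transition_dom (R : realType) (T : topologicalType)
    (c c' : chart R T) : set 'rV[R]_2 :=
  chart_map c @` (chart_dom c `&` chart_dom c').

Definition oriented_atlas (R : realType) (T : topologicalType) (A : set T)
    (atlas : set (chart R T)) : Prop :=
  [/\ forall c, atlas c -> chart_of A c,
      forall x, A x -> exists2 c, atlas c & chart_dom c x &
      forall c c', atlas c -> atlas c' ->
        forall w, transition_dom c c' w ->
          pos_jacobian_within (transition_dom c c')
            (chart_map c' \o chart_inv c) w].

Definition atlas_boundary (R : realType) (T : topologicalType)
    (atlas : set (chart R T)) : set T :=
  [set x | exists2 c, atlas c & chart_dom c x /\ chart_map c x 0 1 = 0].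

(* B is the disjoint union of the n circles gamma i; these being compact and
   connected, they are the connected components of B. *)
Definition disjoint_circles (R : realType) (T : topologicalType) (n : nat)
    (B : set T) (gamma : 'I_n -> set T) : Prop :=
  [/\ forall i, homeomorphic (gamma i) (@circle R),
      forall i j, i != j -> gamma i `&` gamma j = set0 &
      B = \bigcup_(i in [set: 'I_n]) gamma i].

(* S is the closed surface obtained from A by gluing a disc along each of the
   curves gamma i.  When A is compact and S is Hausdorff, the decomposition
   of S below identifies S with the adjunction space. *)
Definition capped_off (R : realType) (T U : topologicalType) (A : set T)
    (n : nat) (gamma : 'I_n -> set T) (S : set U) : Prop :=
  exists (h : T -> U) (e : 'I_n -> Cplx R -> U),
    [/\ embedding_on A h /\ (forall i, embedding_on (@disc R) (e i)),
        forall i, e i @` (@circle R) = h @` gamma i,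
        forall i, h @` A `&` e i @` (@disc R) = e i @` (@circle R),
        forall i j, i != j ->
          e i @` (@disc R) `&` e j @` (@disc R) = set0 &
        S = h @` A `|` \bigcup_(i in [set: 'I_n]) (e i @` (@disc R))].

(* Compact connected orientable surface of genus 1 with exactly n boundary
   circles.  The genus of a compact orientable surface with boundary is that of
   the closed surface obtained by capping off its boundary circles with discs,
   and the closed orientable surface of genus 1 is the torus S^1 x S^1.
   Second countability follows from compactness and the existence of charts. *)
Definition torus_with_boundary (R : realType) (T : topologicalType) (n : nat)
    (A : set T) : Prop :=
  [/\ compact A, connected A, hausdorff_space (subspace A) &
      exists (atlas : set (chart R T)) (gamma : 'I_n -> set T),
        [/\ oriented_atlas A atlas,
            disjoint_circles R (atlas_boundary atlas) gamma &
            capped_off R A gamma (@torus R)]].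

(* Main.v *)
Require Import Defs.
From HB Require Import structures.
From mathcomp Require Import all_boot all_order all_algebra.
From mathcomp Require Import all_classical all_reals all_analysis.
From mathcomp Require Import complex ring lra zify.
Import Order.TTheory GRing.Theory Num.Theory numFieldNormedType.Exports.

(** Put c_1 = p2 - p3, c_2 = p3 - p1, c_3 = p1 - p2.  The forms x_i = c_i (z - p_i)
    have sum zero, so that up to a constant factor of eta the covering is the part over
    the disc of the projective curve

        E :  eta^3 = x_1 x_2 x_3,   x_1 + x_2 + x_3 = 0.

    The whole proof rests on an explicit homeomorphism Phi from E to the torus.  A point
    of the line x_1 + x_2 + x_3 = 0 is a plane triangle with sides x_i, up to similarity;
    it is known from its side lengths and its orientation, and the side lengths fill a
    triangle with barycentric coordinates m (bary), whose edges are the flat triangles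
    and whose vertices are the three branch points.  The symmetric group on three
    letters, a dihedral group, acts on E by the cube roots of unity on eta and by complex
    conjugation.  With the resolvents U, V of (x_1, x_2, x_3) one has
    27 x_1 x_2 x_3 = U^3 + V^3, and |U| <= |V| says that the triangle is positively
    oriented or flat.  Then (eta V^* )^3 has positive real part unless eta = 0
    (upper_Re_cube), so that the three sheets over the positive triangles are separated
    by the argument of eta V^*; one of them is a fundamental domain (fund), carried
    homeomorphically by bary onto the triangle.

    On the other side, the torus is the set of triples (a, b, c) of complex numbers of
    modulus 1 with a b c = 1.  The same group permutes the entries, and the triples of
    angles t1 >= t2 >= t3 >= t1 - 1 with zero sum form a triangle (alcove) which is again
    a fundamental domain.  On both sides the stabiliser of a point is trivial in the
    interior, generated by one reflection on an edge, and the whole group at a vertex,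
    and the three reflections are matched (fund_act_alcove, alcove_fixed_fund).  Hence
    equal barycentric coordinates on the two fundamental domains extend to an
    equivariant bijection (Phi_inj, Phi_surj), continuous because the six translates of
    the fundamental domain are closed (Phi_continuous).

    Outside the disc, with zeta = 1 / z, the product of the 1 - p i zeta has the cube
    root rho because each factor has positive real part.  So the rest of E consists of
    three discs (cap), whose boundaries are the three components (rim) of the part of the
    covering over the unit circle: this gives the genus and the boundary (X_capped_off).
    The covering is connected because segments ending at p1 lift to it (path_to_branch).
    For the oriented atlas, the coordinate away from the branch points is the Cayley
    transform of z (zchart), which flattens the unit circle; at a branch point p it is a
    cube root of z - p, namely y divided by a cube root of the other two factors (bchart).
    All transition maps are holomorphic with non-zero derivative (zcoord_transition). *)

Set Implicit Arguments.
Unset Strict Implicit.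
Unset Printing Implicit Defensive.
Local Open Scope classical_set_scope.
Local Open Scope ring_scope.
Local Open Scope complex_scope.
Local Notation Re := complex.Re.
Local Notation Im := complex.Im.
Local Notation "z ^*" := (conjc z) : ring_scope.

(** * Complex arithmetic in real coordinates *)

Section ComplexCoordinates.
Variable R : realType.
Implicit Types z w y : R[i].

Lemma ReD z w : Re (z + w) = Re z + Re w. Proof. by case: z w => [? ?] []. Qed.
Lemma ImD z w : Im (z + w) = Im z + Im w. Proof. by case: z w => [? ?] []. Qed.
Lemma ReN z : Re (- z) = - Re z. Proof. by case: z. Qed.
Lemma ImN z : Im (- z) = - Im z. Proof. by case: z. Qed.
Lemma ReM z w : Re (z * w) = Re z * Re w - Im z * Im w.
Proof. by case: z w => [? ?] []. Qed.
Lemma ImM z w : Im (z * w) = Re z * Im w + Im z * Re w.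
Proof. by case: z w => [? ?] []. Qed.
Lemma ReJ z : Re z^* = Re z. Proof. by case: z. Qed.
Lemma ImJ z : Im z^* = - Im z. Proof. by case: z. Qed.
Lemma Re1 : Re (1 : R[i]) = 1. Proof. by []. Qed.
Lemma Im1 : Im (1 : R[i]) = 0. Proof. by []. Qed.
Lemma Re0 : Re (0 : R[i]) = 0. Proof. by []. Qed.
Lemma Im0 : Im (0 : R[i]) = 0. Proof. by []. Qed.
Lemma Ren n : Re (n%:R : R[i]) = n%:R.
Proof. by elim: n => // n IH; rewrite -addn1 !natrD ReD IH. Qed.
Lemma Imn n : Im (n%:R : R[i]) = 0.
Proof. by elim: n => // n IH; rewrite -addn1 natrD ImD IH addr0. Qed.
Lemma conjcD z w : (z + w)^* = z^* + w^*. Proof. exact: rmorphD. Qed.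
Lemma conjcN z : (- z)^* = - z^*. Proof. exact: rmorphN. Qed.
Lemma conjcM z w : (z * w)^* = z^* * w^*. Proof. exact: rmorphM. Qed.
Lemma conjcX z n : (z ^+ n)^* = z^* ^+ n. Proof. exact: rmorphXn. Qed.

Definition ReImE := (Ren, Imn, ReD, ImD, ReN, ImN, ReM, ImM, ReJ, ImJ,
  Re1, Im1, Re0, Im0).

Lemma eqC z w : Re z = Re w -> Im z = Im w -> z = w.
Proof. by case: z w => [? ?] [? ?] /= -> ->. Qed.

Definition nsq z : R := Re z ^+ 2 + Im z ^+ 2.

Lemma nsq_ge0 z : 0 <= nsq z.
Proof. by rewrite addr_ge0 // sqr_ge0. Qed.

Lemma nsqM z w : nsq (z * w) = nsq z * nsq w.
Proof. by rewrite /nsq !ReImE; ring. Qed.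

Lemma nsqX z n : nsq (z ^+ n) = nsq z ^+ n.
Proof.
elim: n => [|n IH]; last by rewrite !exprS nsqM IH.
by rewrite !expr0 /nsq Re1 Im1 expr1n expr0n addr0.
Qed.

Lemma nsqJ z : nsq z^* = nsq z.
Proof. by rewrite /nsq ReJ ImJ sqrrN. Qed.

Lemma nsqN z : nsq (- z) = nsq z.
Proof. by rewrite /nsq ReN ImN !sqrrN. Qed.

Lemma nsq_eq0 z : (nsq z == 0) = (z == 0).
Proof. by rewrite /nsq paddr_eq0 ?sqr_ge0 // !sqrf_eq0 eq_complex. Qed.

Lemma nsq_gt0 z : (0 < nsq z) = (z != 0).
Proof. by rewrite lt_def nsq_ge0 andbT nsq_eq0. Qed.

Lemma nsqB z w : nsq (z - w) = nsq z + nsq w - 2 * Re (z * w^*).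
Proof. by rewrite /nsq !ReImE; ring. Qed.

Lemma nsqD z w : nsq (z + w) = nsq z + nsq w + 2 * Re (z * w^*).
Proof. by rewrite /nsq !ReImE; ring. Qed.

Lemma nsqE z : (nsq z)%:C = z * z^*.
Proof. by apply: eqC; rewrite !ReImE /= /nsq; ring. Qed.

Lemma normC_sqrt z : `|z| = (Num.sqrt (nsq z))%:C.
Proof. exact: normc_def. Qed.

Definition cmod z : R := Num.sqrt (nsq z).

Lemma cmod_ge0 z : 0 <= cmod z. Proof. exact: sqrtr_ge0. Qed.
Lemma cmodX2 z : cmod z ^+ 2 = nsq z. Proof. by rewrite sqr_sqrtr ?nsq_ge0. Qed.
Lemma cmod_eq0 z : (cmod z == 0) = (z == 0).
Proof. by rewrite sqrtr_eq0 -nsq_eq0 eq_le nsq_ge0 andbT. Qed.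
Lemma cmod_gt0 z : (0 < cmod z) = (z != 0).
Proof. by rewrite lt_def cmod_ge0 andbT cmod_eq0. Qed.
Lemma cmodM z w : cmod (z * w) = cmod z * cmod w.
Proof. by rewrite /cmod nsqM sqrtrM ?nsq_ge0. Qed.
Lemma cmodJ z : cmod z^* = cmod z. Proof. by rewrite /cmod nsqJ. Qed.
Lemma cmodN z : cmod (- z) = cmod z. Proof. by rewrite /cmod nsqN. Qed.
Lemma cmodE z : `|z| = (cmod z)%:C. Proof. exact: normC_sqrt. Qed.
Lemma cmod0 : cmod 0 = 0. Proof. by apply/eqP; rewrite cmod_eq0. Qed.
Lemma cmodD z w : cmod (z + w) <= cmod z + cmod w.
Proof. by rewrite -lecR rmorphD /= -!cmodE ler_normD. Qed.
Lemma cmodB z w : cmod (z - w) = cmod (w - z).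
Proof. by rewrite -cmodN opprB. Qed.
Lemma Re_le_cmod z : `|Re z| <= cmod z.
Proof. by rewrite -sqrtr_sqr ler_wsqrtr // lerDl sqr_ge0. Qed.
Lemma Im_le_cmod z : `|Im z| <= cmod z.
Proof. by rewrite -sqrtr_sqr ler_wsqrtr // lerDr sqr_ge0. Qed.
Lemma cmod_le_ReIm z : cmod z <= `|Re z| + `|Im z|.
Proof.
rewrite -(@ler_pXn2r _ 2) ?nnegrE ?cmod_ge0 ?addr_ge0 // cmodX2 sqrrD.
by rewrite !real_normK ?num_real // addrAC lerDl mulrn_wge0 // mulr_ge0.
Qed.

Lemma cmod_le z w : (cmod z <= cmod w) = (nsq z <= nsq w).
Proof. by rewrite -!cmodX2 ler_pXn2r ?nnegrE ?cmod_ge0. Qed.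

Lemma normC_le z w : (`|z| <= `|w|) = (nsq z <= nsq w).
Proof. by rewrite !cmodE lecR cmod_le. Qed.

Lemma normC_eq1 z : (`|z| = 1) <-> (nsq z = 1).
Proof.
rewrite cmodE -cmodX2; split=> [[->]|h]; first by rewrite expr1n.
have /eqP : cmod z ^+ 2 == 1 ^+ 2 by rewrite h expr1n.
by move/eqP; rewrite eqrXn2 ?cmod_ge0 ?ler01 // => /eqP ->.
Qed.

Lemma normC_le1 z : (`|z| <= 1) = (nsq z <= 1).
Proof. by rewrite -(normr1 R[i]) normC_le /nsq Re1 Im1 expr1n expr0n addr0. Qed.

Lemma normC_lt1 z : (`|z| < 1) = (nsq z < 1).
Proof.
have h : `|1 : R[i]| <= `|z| = (1 <= nsq z).
  by rewrite normC_le {1}/nsq Re1 Im1 expr1n expr0n addr0.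
by rewrite normr1 in h; rewrite real_ltNge ?num_real ?normr_real ?real1 // h -ltNge.
Qed.

Lemma cmod_real (r : R) : 0 <= r -> cmod r%:C = r.
Proof. by move=> r0; rewrite /cmod /nsq /= expr0n addr0 sqrtr_sqr ger0_norm. Qed.

(** ** Cube roots of unity *)

Definition omega : R[i] := (- 2^-1) +i* (Num.sqrt 3 / 2).

Lemma sqrt3_sq : (Num.sqrt 3 : R) ^+ 2 = 3.
Proof. by rewrite sqr_sqrtr. Qed.

Lemma sqrt3_gt0 : 0 < (Num.sqrt 3 : R).
Proof. by rewrite sqrtr_gt0. Qed.

Lemma omega_sq : omega ^+ 2 = omega^*.
Proof. by have h := sqrt3_sq; apply: eqC; rewrite expr2 !ReImE /omega /=; nra. Qed.

Lemma omega_sum : 1 + omega + omega ^+ 2 = 0.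
Proof. by rewrite omega_sq; apply: eqC; rewrite !ReImE /omega /=; lra. Qed.

Lemma omega2E : omega ^+ 2 = - 1 - omega.
Proof. by apply/eqP; rewrite -subr_eq0 -omega_sum; apply/eqP; ring. Qed.

Lemma omega3 : omega ^+ 3 = 1.
Proof.
rewrite exprS omega2E mulrBr -expr2 omega2E; ring.
Qed.

Lemma omega_neq0 : omega != 0.
Proof. by apply: contra_neq (oner_neq0 R[i]) => h; rewrite -omega3 h expr0n. Qed.

Lemma omega_neq1 : omega != 1.
Proof. by rewrite eq_complex negb_and /omega /=; apply/orP; left; apply/eqP; lra. Qed.

Lemma omegaJ : omega^* = omega ^+ 2. Proof. by rewrite omega_sq. Qed.

Lemma nsq_omega : nsq omega = 1.
Proof. by have h := sqrt3_sq; rewrite /nsq /omega /=; nra. Qed.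

Lemma nsq_omegaX k : nsq (omega ^+ k) = 1.
Proof. by rewrite nsqX nsq_omega expr1n. Qed.

Lemma factor_cubes z w :
  z ^+ 3 - w ^+ 3 = (z - w) * (z - omega * w) * (z - omega ^+ 2 * w).
Proof.
have h2 := omega2E; have h3 := omega3.
transitivity (z ^+ 3 - (1 + omega + omega ^+ 2) * z ^+ 2 * w
  + (omega + omega^+ 2 + omega ^+ 3) * z * w ^+ 2 - omega ^+ 3 * w ^+ 3); last by ring.
by rewrite h3 h2; ring.
Qed.

Lemma cube_eq z w : z ^+ 3 = w ^+ 3 -> exists k : 'I_3, z = omega ^+ k * w.
Proof.
move=> h; have /eqP := factor_cubes z w; rewrite h subrr eq_sym !mulf_eq0 !subr_eq0.
case/orP => [/orP[]|] /eqP ->.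
- by exists 0; rewrite expr0 mul1r.
- by exists 1; rewrite expr1.
- by exists (inord 2); rewrite inordK.
Qed.

Lemma cube_root_exists z : exists y, y ^+ 3 = z.
Proof. by exists (3.-root z); rewrite rootCK. Qed.

(** The closed sector of half-angle pi/3 around the positive real axis. *)
Definition sector z := (0 <= Re z) && (Im z ^+ 2 <= 3 * Re z ^+ 2).

(** The closed sector of half-angle pi/6. *)
Definition narrow z := (0 <= Re z) && (3 * Im z ^+ 2 <= Re z ^+ 2).

(** The sector is the set of numbers nearer to 1 than to the other cube roots of
    unity, that is, whose real part is the largest among their three rotates. *)
Lemma sectorP z : reflect
  (Re (omega * z) <= Re z /\ Re (omega ^+ 2 * z) <= Re z) (sector z).
Proof.
have h3 := sqrt3_sq; have p3 := sqrt3_gt0.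
rewrite omega_sq !ReImE /omega /=; set s := Num.sqrt 3 in h3 p3 *.
set a := Re z; set b := Im z.
apply: (iffP andP) => -[h1 h2].
  have h4 : s * b <= 3 * a /\ - (s * b) <= 3 * a.
    apply/andP; rewrite andbC -lerNl -ler_norml -(@ler_pXn2r _ 2) ?nnegrE ?normr_ge0 //; last lra.
    rewrite real_normK ?num_real // !exprMn h3; nra.
  by split; lra.
have h4 : s * b <= 3 * a /\ - (s * b) <= 3 * a by split; lra.
have a0 : 0 <= a by lra.
split => //.
have : (s * b) ^+ 2 <= (3 * a) ^+ 2 by nra.
rewrite !exprMn h3; nra.
Qed.

Lemma sector_rotate z : exists k : 'I_3, sector (omega ^+ k * z).
Proof.
have h1 : omega * (omega * z) = omega ^+ 2 * z by ring.
have h2 : omega ^+ 2 * (omega * z) = z by rewrite mulrA -exprSr omega3 mul1r.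
have h3 : omega ^+ 2 * (omega ^+ 2 * z) = omega * z.
  by rewrite mulrA -exprD (exprD _ 3 1) omega3 mul1r expr1.
have h4 : omega * (omega ^+ 2 * z) = z by rewrite mulrA -exprS omega3 mul1r.
have [h01|h01] := lerP (Re (omega * z)) (Re z).
  have [h02|h02] := lerP (Re (omega ^+ 2 * z)) (Re z).
    by exists 0; rewrite expr0 mul1r; apply/sectorP.
  exists (inord 2); rewrite inordK //; apply/sectorP; rewrite h3 h4; split; lra.
have [h12|h12] := lerP (Re (omega ^+ 2 * z)) (Re (omega * z)).
  by exists 1; rewrite expr1; apply/sectorP; rewrite h1 h2; split; lra.
exists (inord 2); rewrite inordK //; apply/sectorP; rewrite h3 h4; split; lra.
Qed.

Lemma Re_cube z : Re (z ^+ 3) = Re z * (Re z ^+ 2 - 3 * Im z ^+ 2).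
Proof. by rewrite !exprS expr0 !ReImE; ring. Qed.

(** The cube of a non-zero number has negative real part when the absolute value of its
    argument is in ]pi/6, pi/3]. *)
Lemma sector_narrow z : sector z -> 0 <= Re (z ^+ 3) -> narrow z.
Proof.
rewrite Re_cube => /andP[h1 h2] h3; apply/andP; split => //.
move: h1; rewrite le_eqVlt => /predU1P[h|h]; first by rewrite -h in h2 *; nra.
by rewrite pmulr_rge0 // in h3; lra.
Qed.

(** Two arguments in [-pi/6, pi/6] differ by at most pi/3. *)
Lemma narrow_sector z w : narrow z -> narrow w -> sector (z * w^*).
Proof.
move=> /andP[h1 h2] /andP[h3 h4]; rewrite /sector !ReImE.
set a := Re z in h1 h2 *; set b := Im z in h2 *.
set c := Re w in h3 h4 *; set d := Im w in h4 *.
have hac : 0 <= a * c by apply: mulr_ge0.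
have hbd : (3 * (b * d)) ^+ 2 <= (a * c) ^+ 2.
  have : (3 * b ^+ 2) * (3 * d ^+ 2) <= a ^+ 2 * c ^+ 2.
    by apply: ler_pM => //; rewrite mulr_ge0 // sqr_ge0.
  by rewrite !exprMn; lra.
have h5 : `|3 * (b * d)| <= a * c.
  by rewrite -(@ler_pXn2r _ 2) ?nnegrE ?normr_ge0 // real_normK ?num_real.
have {h5} [h5 h6] := ler_normlP _ _ h5.
have h7 : b ^+ 2 * c ^+ 2 *+ 3 <= a ^+ 2 * c ^+ 2.
  by have := ler_wpM2r (sqr_ge0 c) h2; lra.
have h8 : a ^+ 2 * d ^+ 2 *+ 3 <= a ^+ 2 * c ^+ 2.
  by have := ler_wpM2l (sqr_ge0 a) h4; lra.
apply/andP; split; first by lra.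
have h9 : (a * c) ^+ 2 * 4 <= 9 * (a * c - b * - d) ^+ 2 by nra.
nra.
Qed.

(** In the factorisation of z^3 - w^3 by the three rotates of w, the factor z - w is the
    smallest: among these rotates w is the nearest to z, since their arguments differ by
    at most pi/3.  This is the modulus of continuity of the cube root. *)
Lemma narrow_cube_dist z w : narrow z -> narrow w ->
  nsq (z - w) ^+ 3 <= nsq (z ^+ 3 - w ^+ 3).
Proof.
move=> hz hw; have /sectorP[h1 h2] := narrow_sector hz hw.
rewrite factor_cubes !nsqM.
have e1 : nsq (z - omega * w) = nsq z + nsq w - 2 * Re (omega ^+ 2 * (z * w^*)).
  rewrite nsqB nsqM nsq_omega mul1r conjcM omegaJ mulrCA.
  by [].

have e2 : nsq (z - omega ^+ 2 * w) = nsq z + nsq w - 2 * Re (omega * (z * w^*)).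
  by rewrite nsqB nsqM nsq_omegaX mul1r conjcM -omegaJ conjcK mulrCA.
have e3 := nsqB z w.
have g0 := nsq_ge0 (z - w).
rewrite 2!exprS expr1 -mulrA ler_wpM2l // ler_pM //; lra.
Qed.

Lemma narrow_cube_inj z w : narrow z -> narrow w -> z ^+ 3 = w ^+ 3 -> z = w.
Proof.
move=> hz hw h; have := narrow_cube_dist hz hw.
rewrite h subrr {2}/nsq Re0 Im0 expr0n addr0 => h0.
have /eqP : nsq (z - w) ^+ 3 = 0 by apply: le_anti; rewrite h0 exprn_ge0 ?nsq_ge0.
by rewrite expf_eq0 /= nsq_eq0 subr_eq0 => /eqP.
Qed.

(** Any cube root in the sector, which is unique except on the negative real axis;
    on the closed right half-plane it is the principal one. *)
Definition crt z : R[i] := xget 0 [set y | y ^+ 3 = z /\ sector y].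

Lemma crt_spec z : crt z ^+ 3 = z /\ sector (crt z).
Proof.
rewrite /crt; case: xgetP => [y -> //|] h.
have [y hy] := cube_root_exists z; have [k hk] := sector_rotate y.
case: (h (omega ^+ k * y)); split => //.
by rewrite exprMn hy -exprM mulnC exprM omega3 expr1n mul1r.
Qed.

Lemma crtK z : crt z ^+ 3 = z. Proof. by case: (crt_spec z). Qed.

Lemma crt_narrow z : 0 <= Re z -> narrow (crt z).
Proof. by case: (crt_spec z) => h1 h2 h; apply: sector_narrow; rewrite // h1. Qed.

Lemma crt_cube z : narrow z -> 0 <= Re (z ^+ 3) -> crt (z ^+ 3) = z.
Proof.
by move=> h1 h2; apply: narrow_cube_inj => //; [exact: crt_narrow|rewrite crtK].
Qed.

Lemma crt_neq0 z : z != 0 -> crt z != 0.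
Proof. by apply: contra_neq => h; rewrite -(crtK z) h expr0n. Qed.

End ComplexCoordinates.

(** * The dihedral group of order six *)

Section Dihedral.

(** The action of rho^n kappa^b, for a rotation rho = r of order three and a reflection
    kappa = k; the exponent n is a plain natural number, so that one element of the
    group has several names. *)
Definition dih (X : Type) (r k : X -> X) (g : bool * nat) (x : X) : X :=
  iter g.2 r (if g.1 then k x else x).

(** A name of h g^-1. *)
Definition dih_quot (g h : bool * nat) : bool * nat :=
  (g.1 (+) h.1, (h.2 + (if g.1 (+) h.1 then g.2 else 2 * g.2))%N).

Variables (X : Type) (r k : X -> X) (D : X -> Prop).
Hypotheses (rD : forall x, D x -> D (r x)) (kD : forall x, D x -> D (k x)).
Hypothesis r3 : forall x, D x -> r (r (r x)) = x.
Hypothesis kk : forall x, D x -> k (k x) = x.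
Hypothesis kr : forall x, D x -> k (r x) = r (r (k x)).

Lemma iter_rD n x : D x -> D (iter n r x).
Proof. by move=> h; elim: n => //= n; apply: rD. Qed.

Lemma dih_stable g x : D x -> D (dih r k g x).
Proof. by case: g => [[] n] h; apply: iter_rD => //; apply: kD. Qed.

Lemma iter_r3 n x : D x -> iter (3 * n) r x = x.
Proof.
move=> h; elim: n => [|n IH]; first by rewrite muln0.
by rewrite mulnS iterD IH /= r3.
Qed.

Lemma iter_r_mod n x : D x -> iter n r x = iter (n %% 3) r x.
Proof.
by move=> h; rewrite {1}(divn_eq n 3) addnC iterD mulnC iter_r3.
Qed.

Lemma k_iter n x : D x -> k (iter n r x) = iter (2 * n) r (k x).
Proof.
move=> h; elim: n => [|n IH]; first by [].
by rewrite mulnS iterS kr ?IH //; exact: iter_rD.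
Qed.

Lemma dih_quotP g h x : D x ->
  dih r k h x = dih r k (dih_quot g h) (dih r k g x).
Proof.
have aux n m y : D y -> iter (n + 3 * m) r y = iter n r y.
  by move=> Dy; rewrite iterD iter_r3.
case: g h => [b i] [c j] Dx; rewrite /dih /dih_quot /=.
have Dkx := kD Dx.
case: b c => [] [] /=.
- by rewrite -iterD -addnA -mulSnr aux.
- by rewrite k_iter ?kk // -iterD -addnA -mulSn aux.
- by rewrite k_iter // -iterD -addnA -mulSn aux.
- by rewrite -iterD -addnA -mulSnr aux.
Qed.

Lemma dih_inj g x y : D x -> D y -> dih r k g x = dih r k g y -> x = y.
Proof.
move=> Dx Dy h.
have e0 z : D z -> z = dih r k (false, 0%N) z by [].
by rewrite (e0 x) // (e0 y) // (dih_quotP g (false, 0%N) Dx)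
  (dih_quotP g (false, 0%N) Dy) h.
Qed.

Definition dih_inv (g : bool * nat) := dih_quot g (false, 0%N).

Lemma dihVK g x : D x -> dih r k (dih_inv g) (dih r k g x) = x.
Proof. by move=> Dx; rewrite -dih_quotP. Qed.

Lemma dihKV g x : D x -> dih r k g (dih r k (dih_inv g) x) = x.
Proof.
move=> Dx; apply: (@dih_inj (dih_inv g)) => //.
  by do 2!apply: dih_stable.
by rewrite dihVK //; exact: dih_stable.
Qed.

End Dihedral.

(** * The circle and the alcove *)

Section Circle.
Variable R : realType.

(** The parametrisation exp (2 pi i t) of the unit circle. *)
Definition e (t : R) : R[i] := cos (2 * pi * t) +i* sin (2 * pi * t).

Lemma eD s t : e (s + t) = e s * e t.
Proof. by rewrite /e mulrDr cosD sinD; apply: eqC; rewrite !ReImE /=; ring. Qed.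

Lemma eN t : e (- t) = (e t)^*.
Proof. by rewrite /e mulrN cosN sinN. Qed.

Lemma nsq_e t : nsq (e t) = 1.
Proof. by rewrite /nsq /e /= cos2Dsin2. Qed.

Lemma e0 : e 0 = 1.
Proof. by rewrite /e mulr0 cos0 sin0. Qed.

Lemma e1 : e 1 = 1.
Proof. by rewrite /e mulr1 [2 * pi]mulrC mulr_natr cos2pi sin2pi. Qed.

Lemma e_nat n : e n%:R = 1.
Proof. by elim: n => [|n IH]; rewrite ?e0 // -addn1 natrD eD IH e1 mul1r. Qed.

Lemma e_int (n : int) : e n%:~R = 1.
Proof.
by case: n => n; rewrite ?e_nat // NegzE mulrNz eN e_nat conjc1.
Qed.

Lemma eDint t (n : int) : e (t + n%:~R) = e t.
Proof. by rewrite eD e_int mulr1. Qed.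

Lemma e_eq1 t : e t = 1 -> exists n : int, t = n%:~R.
Proof.
move=> h; exists (Num.floor t).
set u := t - (Num.floor t)%:~R.
have hu : e u = 1 by rewrite /u -mulrNz eDint.
have u0 : 0 <= u by rewrite subr_ge0 floor_le.
have u1 : u < 1 by rewrite ltrBlDl -[X in _ + X]/(1%:~R) -intrD; exact: floorD1_gt.
suff : u = 0 by move/eqP; rewrite subr_eq0 => /eqP.
have [hc _] : cos (2 * pi * u) = 1 /\ sin (2 * pi * u) = 0 by case: hu.
have p0 := pi_gt0 R.
have [hh|hh] := lerP (2 * u) 1.
  have : 2 * pi * u = 0.
    apply: cos_inj; rewrite ?in_itv /= ?cos0 ?hc ?lexx ?pi_ge0 //.
    apply/andP; split; nra.
  by move/eqP; rewrite mulf_eq0 (gt_eqF (mulr_gt0 _ p0)) //= => /eqP.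
have : 2 * pi * (1 - u) = 0.
  apply: cos_inj; rewrite ?in_itv /= ?lexx ?pi_ge0 //.
    apply/andP; split; nra.
  have -> : 2 * pi * (1 - u) = - (2 * pi * u) + pi *+ 2 by ring.
  by rewrite cosD2pi cosN hc cos0.
move/eqP; rewrite mulf_eq0 (gt_eqF (mulr_gt0 _ p0)) //= => /eqP; lra.
Qed.

Lemma e_inj s t : e s = e t -> exists n : int, s = t + n%:~R.
Proof.
move=> h; have [|n hn] := @e_eq1 (s - t).
  by rewrite eD eN h -nsqE nsq_e.
by exists n; rewrite -hn; ring.
Qed.

(** The angle is the arc cosine of the real part, in the upper half-plane. *)
Lemma e_surj z : nsq z = 1 -> exists2 t, 0 <= t < 1 & z = e t.
Proof.
case: z => a b; rewrite /nsq /= => h.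
have p0 := pi_gt0 R.
have ha : -1 <= a <= 1.
  rewrite -ler_norml -(@ler_pXn2r _ 2) ?nnegrE // real_normK ?num_real //; nra.
have h1 : cos (acos a) = a by apply: acosK; rewrite in_itv.
have h2 := sin_acos ha.
have h3 := acos_ge0 ha; have h4 := acos_lepi ha.
have e2 : Num.sqrt (1 - a ^+ 2) = `|b|.
  by rewrite (_ : 1 - a ^+ 2 = b ^+ 2) ?sqrtr_sqr // -h; ring.
have h5 : 2 * pi * (acos a / (2 * pi)) = acos a.
  by rewrite mulrC divfK // gt_eqF // mulr_gt0.
have [b0|b0] := lerP 0 b.
  exists (acos a / (2 * pi)).
    rewrite divr_ge0 ?mulr_ge0 ?pi_ge0 //= ltr_pdivrMr ?mulr_gt0 //; lra.
  by rewrite /e h5 h1 h2 e2 ger0_norm.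
exists (1 - acos a / (2 * pi)).
  have : 0 < acos a / (2 * pi).
    rewrite divr_gt0 ?mulr_gt0 // lt_def h3 andbT.
    apply: contraTneq b0 => h0; rewrite -leNgt.
    by move: h2; rewrite h0 sin0 e2 => /esym/eqP; rewrite normr_eq0 => /eqP ->.
  have : acos a / (2 * pi) < 1 by rewrite ltr_pdivrMr ?mulr_gt0 //; lra.
  by move=> ? ?; lra.
by rewrite eD e1 mul1r eN /e h5 h1 h2 e2 /= ltr0_norm // opprK.
Qed.

End Circle.

(** * The torus as a quotient of triangles *)

Section Alcove.
Variable R : realType.

Definition on_torus (t : R[i] * R[i]) := nsq t.1 = 1 /\ nsq t.2 = 1.

(** A pair (a, b) on the torus stands for the triple (a, b, c) with abc = 1;
    the dihedral group permutes the three entries. *)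
Definition rotT (t : R[i] * R[i]) := (t.2, (t.1 * t.2)^*).
Definition flipT (t : R[i] * R[i]) := (t.1, (t.1 * t.2)^*).

Lemma torus_eE t : on_torus t -> exists s, exists u, t = (e s, e u).
Proof.
case: t => a b [/= /e_surj[s _ ->] /e_surj[u _ ->]]; by exists s, u.
Qed.

Lemma rotT_e (s u : R) : rotT (e s, e u) = (e u, e (- s - u)).
Proof. by rewrite -opprD eN eD. Qed.

Lemma flipT_e (s u : R) : flipT (e s, e u) = (e s, e (- s - u)).
Proof. by rewrite -opprD eN eD. Qed.

Lemma e_on_torus s u : on_torus (e s, e u).
Proof. by split; rewrite nsq_e. Qed.

Lemma rotT_torus t : on_torus t -> on_torus (rotT t).
Proof. by move=> /torus_eE[s [u ->]]; rewrite rotT_e; exact: e_on_torus. Qed.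

Lemma flipT_torus t : on_torus t -> on_torus (flipT t).
Proof. by move=> /torus_eE[s [u ->]]; rewrite flipT_e; exact: e_on_torus. Qed.

Lemma rotT3 t : on_torus t -> rotT (rotT (rotT t)) = t.
Proof.
move=> /torus_eE[s [u ->]]; rewrite !rotT_e; congr (e _, e _); ring.
Qed.

Lemma flipTK t : on_torus t -> flipT (flipT t) = t.
Proof.
move=> /torus_eE[s [u ->]]; rewrite !flipT_e; congr (_, e _); ring.
Qed.

Lemma flipT_rotT t : on_torus t -> flipT (rotT t) = rotT (rotT (flipT t)).
Proof.
by move=> /torus_eE[s [u ->]]; rewrite !(rotT_e, flipT_e); congr (e _, e _); ring.
Qed.

Definition actT := dih rotT flipT.

(** The point with barycentric coordinates m in the alcove
    t1 >= t2 >= t3 >= t1 - 1, t1 + t2 + t3 = 0: they are t2 - t3, t1 - t2 and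
    1 - t1 + t3, which vanish on its three walls. *)
Definition alcove (m : R * R * R) : R[i] * R[i] :=
  (e ((2 * m.1.2 + m.1.1) / 3), e ((m.1.1 - m.1.2) / 3)).

Definition simplex (m : R * R * R) :=
  [/\ 0 <= m.1.1, 0 <= m.1.2, 0 <= m.2 & m.1.1 + m.1.2 + m.2 = 1].

Definition vertex (m : R * R * R) := [\/ m.1.1 = 1, m.1.2 = 1 | m.2 = 1].

Definition edge (m : R * R * R) := [\/ m.1.1 = 0, m.1.2 = 0 | m.2 = 0].

Lemma alcove_torus m : on_torus (alcove m).
Proof. exact: e_on_torus. Qed.

Lemma int_small (n : int) : `|n%:~R : R| < 2 ->
  [\/ n%:~R = -1 :> R, n%:~R = 0 :> R | n%:~R = 1 :> R].
Proof.
rewrite -intr_norm (_ : 2 = 2%:~R) // ltr_int => h.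
have : n = -1 \/ n = 0 \/ n = 1 by lia.
by case=> [->|[->|->]]; [apply: Or31|apply: Or32|apply: Or33].
Qed.

Lemma e_close (s t : R) : e s = e t -> `|s - t| < 2 ->
  [\/ s = t - 1, s = t | s = t + 1].
Proof.
move=> /e_inj[n ->]; rewrite addrAC subrr add0r => /int_small[] ->.
- by apply: Or31.
- by apply: Or32; rewrite addr0.
- by apply: Or33.
Qed.

Lemma iter_rotT n t : on_torus t -> iter n rotT t = iter (n %% 3) rotT t.
Proof. exact: (iter_r_mod rotT3). Qed.

(** No two points of the alcove are in the same orbit: the alcove lists the angles of the
    three entries in decreasing order, within one turn, and with zero sum, which
    determines them from the unordered triple. *)
Lemma alcove_inj g m m' : simplex m -> simplex m' ->
  actT g (alcove m) = alcove m' -> m = m'.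
Proof.
case: g => b n; rewrite /actT /dih /=.
have : on_torus (if b then flipT (alcove m) else alcove m).
  by case: b; [apply: flipT_torus|]; exact: alcove_torus.
move=> /iter_rotT ->.
have : (n %% 3 < 3)%N by rewrite ltn_mod.
case: m m' => [[x y] z] [[x' y'] z']; rewrite /simplex /alcove /=.
move=> hn [h1 h2 h3 h4] [h5 h6 h7 h8] h.
have [hx hy] : x = x' /\ y = y'.
  (* Angles with the same exponential differ here by less than two turns, hence by an
     integer between -1 and 1; each of the cases is linear arithmetic. *)
  move: h hn; case: (n %% 3)%N => [|[|[|//]]] /=; case: b;
    rewrite ?(flipT_e, rotT_e) => /pair_equal_spec[/e_close E1 /e_close E2] _;
    (move: (E1 ltac:(rewrite ltr_norml; apply/andP; split; lra)) => {}E1);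
    (move: (E2 ltac:(rewrite ltr_norml; apply/andP; split; lra)) => {}E2);
    by case: E1 => E1; case: E2 => E2; first [exfalso; lra | split; lra].
by congr (_, _, _) => //; lra.
Qed.

Lemma alcove_rot_fixed n m : simplex m -> (n %% 3 != 0)%N ->
  iter n rotT (alcove m) = alcove m -> vertex m.
Proof.
move=> hm hn; rewrite (iter_rotT _ (alcove_torus m)) => h.
have : rotT (alcove m) = alcove m.
  move: hn h; have : (n %% 3 < 3)%N by rewrite ltn_mod.
  case: (n %% 3)%N => [|[|[|//]]] //= _ _ h.
  by rewrite -{1}h rotT3 //; exact: alcove_torus.
case: m hm {h} => [[x y] z]; rewrite /simplex /alcove /vertex /= => -[h1 h2 h3 h4].
rewrite rotT_e => /pair_equal_spec[/e_close E1 /e_close E2].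
move: (E1 ltac:(rewrite ltr_norml; apply/andP; split; lra)) => {}E1.
move: (E2 ltac:(rewrite ltr_norml; apply/andP; split; lra)) => {}E2.
case: E1 => E1; case: E2 => E2; try (by apply: Or31; lra);
  try (by apply: Or32; lra); by apply: Or33; lra.
Qed.

Lemma alcove_flip_fixed n m : simplex m ->
  actT (true, n) (alcove m) = alcove m -> edge m.
Proof.
rewrite /actT /dih /= => hm.
rewrite (iter_rotT _ (flipT_torus (alcove_torus m))) => h.
have hn : (n %% 3 < 3)%N by rewrite ltn_mod.
case: m hm h => [[x y] z]; rewrite /simplex /alcove /edge /= => -[h1 h2 h3 h4].
case: (n %% 3)%N hn => [|[|[|//]]] _ /=;
  rewrite ?(flipT_e, rotT_e) => /pair_equal_spec[/e_close E1 /e_close E2];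
  (move: (E1 ltac:(rewrite ltr_norml; apply/andP; split; lra)) => {}E1);
  (move: (E2 ltac:(rewrite ltr_norml; apply/andP; split; lra)) => {}E2);
  case: E1 => E1; case: E2 => E2; try (by apply: Or31; lra);
  try (by apply: Or32; lra); by apply: Or33; lra.
Qed.

Lemma e_eqint (s t : R) (n : int) : s = t + n%:~R -> e s = e t.
Proof. by move=> ->; rewrite eDint. Qed.

(** At a vertex the three entries coincide. *)
Lemma alcove_vertex_fixed g m : simplex m -> vertex m ->
  actT g (alcove m) = alcove m.
Proof.
move=> hm hv.
have hr : rotT (alcove m) = alcove m /\ flipT (alcove m) = alcove m.
  case: m hm hv => [[x y] z]; rewrite /simplex /alcove /vertex /= => -[h1 h2 h3 h4] hv.
  rewrite rotT_e flipT_e; split; congr pair; case: hv => hv;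
    by [apply: (@e_eqint _ _ 0); rewrite mulr0z; lra
       |apply: (@e_eqint _ _ 1); rewrite mulr1z; lra
       |apply: (@e_eqint _ _ (-1)); rewrite mulrN1z; lra].
case: g => b n; rewrite /actT /dih /=; case: b; rewrite ?hr.2;
  by elim: n => //= n ->; rewrite hr.1.
Qed.

(** On a wall of the alcove two of the three entries coincide, and the transposition of
    these two entries is the reflection which belongs to the wall. *)
Lemma alcove_edge_fixed m : simplex m ->
  [/\ m.1.1 = 0 -> flipT (alcove m) = alcove m,
      m.1.2 = 0 -> rotT (rotT (flipT (alcove m))) = alcove m &
      m.2 = 0 -> rotT (flipT (alcove m)) = alcove m].
Proof.
case: m => [[x y] z]; rewrite /simplex /alcove /= => -[h1 h2 h3 h4].
split=> h; rewrite ?(flipT_e, rotT_e); congr pair;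
  by [apply: (@e_eqint _ _ 0); rewrite mulr0z; lra
     |apply: (@e_eqint _ _ 1); rewrite mulr1z; lra
     |apply: (@e_eqint _ _ (-1)); rewrite mulrN1z; lra].
Qed.

Lemma alcove_of (x y z : R) : x + y + z = 0 -> y <= x -> z <= y -> x - 1 <= z ->
  exists2 m, simplex m & (e x, e y) = alcove m.
Proof.
move=> h1 h2 h3 h4; exists (y - z, x - y, 1 - (x - z)).
  by split=> /=; lra.
by rewrite /alcove /=; congr (e _, e _); lra.
Qed.

(** Angles in [0, 1[ whose exponentials have product 1 add up to n = 0, 1 or 2.  Lowering
    the n largest of them by one turn makes the sum zero, and n rotations put them back
    into decreasing order. *)
Lemma sorted_alcove (p q r : R) (n : int) : p + q + r = n%:~R ->
  q <= p -> r <= q -> 0 <= r -> p < 1 ->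
  exists j, exists2 m, simplex m & iter j rotT (e p, e q) = alcove m.
Proof.
move=> h h1 h2 h3 h4.
have : n = 0 \/ n = 1 \/ n = 2.
  have : (0 <= n)%R by rewrite -(ler_int R) -h; lra.
  have : (n < 3)%R by rewrite -(ltr_int R) -h; lra.
  by lia.
case=> [hn|[hn|hn]]; rewrite {n}hn in h.
- by exists 0%N; apply: (@alcove_of p q r) => //; lra.
- exists 1%N; rewrite /= rotT_e.
  have [||||m hm E] := @alcove_of q r (p - 1); try lra.
  exists m => //; rewrite -E; congr pair; apply: (@e_eqint _ _ (-1)); rewrite mulrN1z; lra.
- exists 2; rewrite /= !rotT_e.
  have [||||m hm E] := @alcove_of r (p - 1) (q - 1); try lra.
  exists m => //; rewrite -E; congr pair.
    by apply: (@e_eqint _ _ (-2)); rewrite mulrNz; lra.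
  by apply: (@e_eqint _ _ 1); rewrite mulr1z; lra.
Qed.

Lemma alcove_cover t : on_torus t ->
  exists g, exists2 m, simplex m & actT g t = alcove m.
Proof.
case: t => a b [/= /e_surj[p /andP[p0 p1] ->] /e_surj[q /andP[q0 q1] ->]].
pose n : int := Num.floor (- p - q); pose r := - p - q - n%:~R.
have r0 : 0 <= r by rewrite subr_ge0 floor_le.
have r1 : r < 1 by rewrite ltrBlDl -[X in _ < _ + X]/(1%:~R) -intrD; exact: floorD1_gt.
have hr : p + q + r = (- n)%:~R by rewrite /r mulrNz; ring.
have er : e r = e (- p - q) by apply: (@e_eqint _ _ (- n)); rewrite mulrNz.
have er1 : e (- p - r) = e q by apply: (@e_eqint _ _ n); rewrite /r; ring.
have er2 : e (- q - r) = e p by apply: (@e_eqint _ _ n); rewrite /r; ring.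
have key x y z i fl : actT (fl, i) (e p, e q) = (e x, e y) ->
  x + y + z = p + q + r /\ [/\ y <= x, z <= y, 0 <= z & x < 1] ->
  exists g, exists2 m, simplex m & actT g (e p, e q) = alcove m.
  rewrite hr => h6 [h1 [h2 h3 h4 h5]].
  have [j [m hm h]] := sorted_alcove h1 h2 h3 h4 h5.
  by exists (fl, (j + i)%N), m => //; rewrite /actT /dih /= iterD [iter i _ _]h6.
have [pq|pq] := lerP q p; have [qr|qr] := lerP r q; have [pr|pr] := lerP r p;
  try (exfalso; lra).
- by apply: (key p q r 0%N false); last by split; [|split]; lra.
- apply: (key p r q 0%N true); last by split; [|split]; lra.
  by rewrite /actT /dih /= flipT_e er.
- apply: (key r p q 2 false); last by split; [|split]; lra.
  by rewrite /actT /dih /= !rotT_e -er; congr (_, e _); ring.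
- apply: (key q p r 2 true); last by split; [|split]; lra.
  by rewrite /actT /dih /= flipT_e !rotT_e; congr (e _, e _); ring.
- apply: (key q r p 1%N false); last by split; [|split]; lra.
  by rewrite /actT /dih /= rotT_e er.
- apply: (key r q p 1%N true); last by split; [|split]; lra.
  by rewrite /actT /dih /= flipT_e rotT_e -er; congr (_, e _); ring.
Qed.


End Alcove.

(** * The homogeneous cubic curve *)

Section Cubic.
Variable R : realType.
Implicit Types x y z w : R[i].

Local Notation omega := (omega R).

(** Resolvents of a triple: the coordinates which diagonalise its cyclic shift. *)
Definition resU x y z := x + omega ^+ 2 * y + omega * z.
Definition resV x y z := x + omega * y + omega ^+ 2 * z.

Let o2 := omega2E R.

Lemma sum0E x y z : x + y + z = 0 -> x = - y - z.
Proof. by move=> h; apply/eqP; rewrite -subr_eq0 -h; apply/eqP; ring. Qed.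

Lemma resU_rot x y z : resU y z x = omega * resU x y z.
Proof. by rewrite /resU; ring: o2. Qed.

Lemma resV_rot x y z : resV y z x = omega ^+ 2 * resV x y z.
Proof. by rewrite /resV; ring: o2. Qed.

Lemma nsq_resU_rot x y z : nsq (resU y z x) = nsq (resU x y z).
Proof. by rewrite resU_rot nsqM nsq_omega mul1r. Qed.

Lemma nsq_resV_rot x y z : nsq (resV y z x) = nsq (resV x y z).
Proof. by rewrite resV_rot nsqM nsq_omegaX mul1r. Qed.

Lemma resU_conj x y z : resU x^* y^* z^* = (resV x y z)^*.
Proof. by rewrite /resU /resV !(conjcD, conjcM, conjcX) omegaJ; ring: o2. Qed.

Lemma resV_conj x y z : resV x^* y^* z^* = (resU x y z)^*.
Proof. by rewrite -[resV _ _ _]conjcK -resU_conj !conjcK. Qed.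

Lemma res0 x y z : x + y + z = 0 -> 3 * x = resU x y z + resV x y z.
Proof. by move=> /sum0E ->; rewrite /resU /resV; ring: o2. Qed.

Lemma res1 x y z : x + y + z = 0 ->
  3 * y = omega * resU x y z + omega ^+ 2 * resV x y z.
Proof. by move=> /sum0E ->; rewrite /resU /resV; ring: o2. Qed.

Lemma res2 x y z : x + y + z = 0 ->
  3 * z = omega ^+ 2 * resU x y z + omega * resV x y z.
Proof. by move=> /sum0E ->; rewrite /resU /resV; ring: o2. Qed.

Lemma res_cubes x y z : x + y + z = 0 ->
  27 * (x * y * z) = resU x y z ^+ 3 + resV x y z ^+ 3.
Proof. by move=> /sum0E ->; rewrite /resU /resV; ring: o2. Qed.

Lemma res_orient x y z : x + y + z = 0 ->
  nsq (resV x y z) - nsq (resU x y z) = 6 * Num.sqrt 3 * Im (y * z^*).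
Proof.
move=> /sum0E ->; have h3 := @sqrt3_sq R.
by rewrite /resU /resV omega_sq /nsq !ReImE /omega /=; field: h3.
Qed.

Lemma res_sum_sq x y z : x + y + z = 0 ->
  nsq (resU x y z) + nsq (resV x y z) = 3 * (nsq x + nsq y + nsq z).
Proof.
move=> /sum0E ->; have h3 := @sqrt3_sq R.
by rewrite /resU /resV omega_sq /nsq !ReImE /omega /=; field: h3.
Qed.

Lemma res_prod x y z : x + y + z = 0 -> resU x y z * (resV x y z)^* =
  3 * ((nsq x)%:C + omega * (nsq y)%:C + omega ^+ 2 * (nsq z)%:C).
Proof.
move=> /sum0E ->; rewrite !nsqE /resU /resV.
by rewrite !(conjcD, conjcN, conjcM, conjcX) !omegaJ; ring: o2.
Qed.

Lemma sector_Re_ge (N : R) z : 0 <= N -> nsq z = N ^+ 2 -> sector z ->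
  N <= 2 * Re z.
Proof.
move=> N0 hN /andP[h1 h2]; rewrite -(@ler_pXn2r _ 2) ?nnegrE ?mulr_ge0 // -hN.
by rewrite /nsq exprMn; lra.
Qed.

(** When the resolvents U, V have the same modulus the triangle is flat, and the
    argument of U V^* tells which of the sides is the sum of the other two: by res_orient
    y and z have real ratio, and 9 Re (y z^* ) = 2 Re (U V^* ) - |U V^*| is non-negative
    when U V^* is in the sector. *)
Lemma res_arc x y z : x + y + z = 0 ->
  nsq (resU x y z) = nsq (resV x y z) ->
  sector (resU x y z * (resV x y z)^*) -> cmod x = cmod y + cmod z.
Proof.
move=> h hUV hs.
have hI : Im (y * z^*) = 0.
  have /eqP := res_orient h; rewrite hUV subrr eq_sym mulf_eq0.
  by rewrite gt_eqF ?mulr_gt0 ?sqrt3_gt0 //= => /eqP.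
have hR : 0 <= Re (y * z^*).
  have e9 : 9 * (y * z^*) = (omega ^+ 2 * (nsq (resU x y z))%:C
     + omega * (nsq (resV x y z))%:C) + resU x y z * (resV x y z)^*
     + (resU x y z * (resV x y z)^*)^*.
    transitivity ((3 * y) * (3 * z)^*); first by rewrite conjcM conjc_nat; ring.
    rewrite (res1 h) (res2 h) !nsqE; move: (resU _ _ _) (resV _ _ _) => U V.
    by rewrite !(conjcD, conjcM, conjcX, conjcK) !omegaJ; ring: o2.
  have : Re (9 * (y * z^*)) = 9 * Re (y * z^*) by rewrite ReM Ren Imn mul0r subr0.
  have : nsq (resV x y z) <= 2 * Re (resU x y z * (resV x y z)^*).
    apply: sector_Re_ge => //; first exact: nsq_ge0.
    by rewrite nsqM nsqJ hUV expr2.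
  rewrite e9 hUV omega_sq; move: (nsq _) (resU _ _ _ * _) => N M.
  by rewrite !ReImE /omega /=; lra.
have e1 : cmod y * cmod z = Re (y * z^*).
  rewrite -(cmodJ z) -cmodM /cmod /nsq hI expr0n addr0 sqrtr_sqr ger0_norm //.
have : cmod x ^+ 2 = (cmod y + cmod z) ^+ 2.
  rewrite sqrrD !cmodX2 -mulr_natl e1 (sum0E h) -opprD nsqN nsqD; ring.
by move/eqP; rewrite eqrXn2 ?addr_ge0 ?cmod_ge0 // => /eqP.
Qed.

(** The case of equality in the triangle inequality. *)
Lemma collinear_Im0 y z : cmod (y + z) = cmod y + cmod z -> Im (y * z^*) = 0.
Proof.
move=> h; have : cmod (y + z) ^+ 2 = (cmod y + cmod z) ^+ 2 by rewrite h.
rewrite sqrrD !cmodX2 nsqD => h1.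
have e1 : Re (y * z^*) = cmod y * cmod z by lra.
have : nsq (y * z^*) = Re (y * z^*) ^+ 2 by rewrite e1 nsqM nsqJ exprMn !cmodX2.
by rewrite /nsq => /eqP; rewrite addrC -subr_eq0 addrK sqrf_eq0 => /eqP.
Qed.

(** Homogeneous coordinates on the curve eta^3 = x y z, x + y + z = 0. *)
Record hpt := Hpt { hx : R[i]; hy : R[i]; hz : R[i]; heta : R[i] }.
Implicit Types P Q : hpt.

Definition curve P := [/\ hx P + hy P + hz P = 0,
  heta P ^+ 3 = hx P * hy P * hz P & (hx P, hy P) <> (0, 0)].

Definition scale (l : R[i]) P :=
  Hpt (l * hx P) (l * hy P) (l * hz P) (l * heta P).

Definition rotE P := Hpt (hx P) (hy P) (hz P) (omega * heta P).
Definition flipE P := Hpt (hx P)^* (hy P)^* (hz P)^* (heta P)^*.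
Definition actE := dih rotE flipE.

Definition hU P := resU (hx P) (hy P) (hz P).
Definition hV P := resV (hx P) (hy P) (hz P).

(** By res_orient, this says that the triangle is positively oriented or flat. *)
Definition upper P := nsq (hU P) <= nsq (hV P).

(** One of the three sheets over the closed half-plane of positively oriented or flat
    triangles: a fundamental domain for the dihedral group. *)
Definition fund P := upper P && sector (heta P * (hV P)^*).

Definition perim P := cmod (hx P) + cmod (hy P) + cmod (hz P).

(** Triangles with sides x, y, z are classified up to similarity, apart from
    their orientation, by their side lengths; in the coordinates below the
    triangle inequalities say that all coordinates are non-negative. *)
Definition bary P : R * R * R :=
  ((cmod (hy P) + cmod (hz P) - cmod (hx P)) / perim P,
   (cmod (hz P) + cmod (hx P) - cmod (hy P)) / perim P,
   (cmod (hx P) + cmod (hy P) - cmod (hz P)) / perim P).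

Lemma rotE3 P : rotE (rotE (rotE P)) = P.
Proof.
by case: P => x y z t; rewrite /rotE /= !mulrA -!expr2 -exprSr omega3 mul1r.
Qed.

Lemma flipEK P : flipE (flipE P) = P.
Proof. by case: P => x y z t; rewrite /flipE /= !conjcK. Qed.

Lemma flipE_rotE P : flipE (rotE P) = rotE (rotE (flipE P)).
Proof.
by case: P => x y z t; rewrite /flipE /rotE /= conjcM omegaJ mulrA -expr2.
Qed.

Lemma curve_rot P : curve P -> curve (rotE P).
Proof. by case=> h1 h2 h3; split => //=; rewrite exprMn omega3 mul1r. Qed.

Lemma curve_flip P : curve P -> curve (flipE P).
Proof.
case=> h1 h2 h3; split => /=.
- by rewrite -!conjcD h1 conjc0.
- by rewrite -conjcX h2 !conjcM.
- by move=> [] /eqP; rewrite conjc_eq0 => /eqP e1 /eqP; rewrite conjc_eq0 => /eqP e2;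
    apply: h3; rewrite e1 e2.
Qed.

Lemma curve_act g P : curve P -> curve (actE g P).
Proof. exact: (dih_stable curve_rot curve_flip). Qed.

Lemma curve_scale l P : l != 0 -> curve P -> curve (scale l P).
Proof.
move=> l0 [h1 h2 h3]; split => /=.
- by rewrite -!mulrDr h1 mulr0.
- by rewrite exprMn h2; ring.
- by move=> [] /eqP; rewrite mulf_eq0 (negPf l0) /= => /eqP e1 /eqP;
   rewrite mulf_eq0 (negPf l0) /= => /eqP e2; apply: h3; rewrite e1 e2.
Qed.

Lemma hU_scale l P : hU (scale l P) = l * hU P.
Proof. by rewrite /hU /resU /=; ring. Qed.
Lemma hV_scale l P : hV (scale l P) = l * hV P.
Proof. by rewrite /hV /resV /=; ring. Qed.
Lemma hU_flip P : hU (flipE P) = (hV P)^*. Proof. exact: resU_conj. Qed.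
Lemma hV_flip P : hV (flipE P) = (hU P)^*. Proof. exact: resV_conj. Qed.
Lemma hU_rot n P : hU (iter n rotE P) = hU P.
Proof. by rewrite /hU; elim: n. Qed.
Lemma hV_rot n P : hV (iter n rotE P) = hV P.
Proof. by rewrite /hV; elim: n. Qed.
Lemma eta_rot n P : heta (iter n rotE P) = omega ^+ n * heta P.
Proof. by elim: n => [|n IH] /=; rewrite ?mul1r // IH exprS mulrA. Qed.

Lemma bary_flip P : bary (flipE P) = bary P.
Proof. by rewrite /bary /perim /= !cmodJ. Qed.

Lemma bary_act g P : bary (actE g P) = bary P.
Proof.
case: g => b n; rewrite -[RHS](_ : bary (if b then flipE P else P) = _).
  by rewrite /actE /dih /=; elim: n.
by case: b; rewrite ?bary_flip.
Qed.

Lemma actE_scale g l P : l != 0 -> exists2 l', l' != 0 &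
  actE g (scale l P) = scale l' (actE g P).
Proof.
move=> l0; case: g => b n.
have rotS l' Q : iter n rotE (scale l' Q) = scale l' (iter n rotE Q).
  elim: n => //= n ->; rewrite /rotE /scale /=; congr Hpt; ring.
case: b; last by exists l => //; rewrite /actE /dih /= rotS.
exists l^*; rewrite ?conjc_eq0 // /actE /dih /= -rotS.
by congr (iter _ _ _); rewrite /flipE /scale /= !conjcM.
Qed.

Lemma hUV_neq0 P : curve P -> ~ (hU P = 0 /\ hV P = 0).
Proof.
move=> [h1 h2 h3] [hu hv]; apply: h3.
have n3 : (3 : R[i]) != 0 by rewrite pnatr_eq0.
have := res0 h1; have := res1 h1; rewrite -/(hU P) -/(hV P) hu hv !mulr0 addr0.
move=> /eqP; rewrite mulf_eq0 (negPf n3) => /eqP ->.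
by move=> /eqP; rewrite mulf_eq0 (negPf n3) => /eqP ->.
Qed.

Lemma upper_V_neq0 P : curve P -> upper P -> hV P != 0.
Proof.
move=> hP hu; apply/eqP => hv; apply: (hUV_neq0 hP); split => //.
apply/eqP; rewrite -nsq_eq0 eq_le nsq_ge0 andbT.
by move: hu; rewrite /upper hv {2}/nsq Re0 Im0 expr0n addr0.
Qed.

Lemma perim_gt0 P : curve P -> 0 < perim P.
Proof.
move=> [h1 h2 h3]; rewrite /perim.
have := cmod_ge0 (hx P); have := cmod_ge0 (hy P); have := cmod_ge0 (hz P).
have [e1|] := eqVneq (hx P) 0; last by rewrite -cmod_gt0; lra.
have [e2|] := eqVneq (hy P) 0; last by rewrite -cmod_gt0; lra.
by case: h3; rewrite e1 e2.
Qed.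

Lemma bary_simplex P : curve P -> simplex (bary P).
Proof.
move=> hP; have L := perim_gt0 hP; case: (hP) => h1 h2 h3.
split=> /=; rewrite ?divr_ge0 ?(ltW L) // ?subr_ge0.
- by rewrite (sum0E h1) -opprD cmodN cmodD.
- have h : hy P + hz P + hx P = 0 by rewrite -h1; ring.
  by rewrite (sum0E h) -opprD cmodN cmodD.
- have h : hz P + hx P + hy P = 0 by rewrite -h1; ring.
  by rewrite (sum0E h) -opprD cmodN cmodD.
- by rewrite -!mulrDl -[RHS](mulfV (lt0r_neq0 L)); congr (_ / _); rewrite /perim; ring.
Qed.

(** A barycentric coordinate equals 1 when one of the sides vanishes. *)
Lemma vertex_eta P : curve P -> vertex (bary P) <-> heta P = 0.
Proof.
move=> hP; have L := perim_gt0 hP; case: (hP) => h1 h2 h3.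
have Ln := lt0r_neq0 L.
have aux a : (a / perim P = 1) = (a = perim P).
  apply/propext; split=> [h|->]; last by rewrite mulfV.
  by apply: (mulIf (invr_neq0 Ln)); rewrite h mulfV.
rewrite /vertex /= !aux; split=> [h|h].
  suff : heta P ^+ 3 == 0 by rewrite expf_eq0 => /eqP.
  rewrite h2 !mulf_eq0 -!cmod_eq0 -orbA.
  by apply/or3P; case: h => h; [apply: Or31|apply: Or32|apply: Or33];
    apply/eqP; move: h; rewrite /perim; lra.
have /eqP : hx P * hy P * hz P = 0 by rewrite -h2 h expr0n.
rewrite !mulf_eq0 -!cmod_eq0 /perim -orbA => /or3P[] /eqP ->.
- by apply: Or31; ring.
- by apply: Or32; ring.
- by apply: Or33; ring.
Qed.

Lemma edge_degenerate P : curve P -> edge (bary P) -> nsq (hU P) = nsq (hV P).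
Proof.
move=> hP; have L := perim_gt0 hP; case: (hP) => h1 h2 h3.
have h1' : hy P + hz P + hx P = 0 by rewrite -h1; ring.
have h1'' : hz P + hx P + hy P = 0 by rewrite -h1; ring.
have aux a : (a / perim P = 0) -> a = 0.
  by move/eqP; rewrite mulf_eq0 invr_eq0 (gt_eqF L) orbF => /eqP.
have key x y z : x + y + z = 0 -> cmod y + cmod z - cmod x = 0 -> Im (y * z^*) = 0.
  move=> h0 h; apply: collinear_Im0; rewrite -cmodN opprD -(sum0E h0); lra.
case=> /= /aux.
- move=> /(key _ _ _ h1) h; have := res_orient h1.
  by rewrite h mulr0 => /eqP; rewrite subr_eq0 eq_sym => /eqP.
- move=> /(key _ _ _ h1') h; have := res_orient h1'.
  rewrite h mulr0 => /eqP; rewrite subr_eq0 eq_sym => /eqP.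
  by rewrite nsq_resU_rot nsq_resV_rot.
- move=> /(key _ _ _ h1'') h; have := res_orient h1''.
  rewrite h mulr0 => /eqP; rewrite subr_eq0 eq_sym => /eqP.
  by rewrite 2!nsq_resU_rot 2!nsq_resV_rot.
Qed.

(** Since 27 (eta V^* )^3 = |V|^6 + (U V^* )^3 and |U| <= |V|, the real part is
    non-negative, and vanishes only if (U V^* )^3 = - |V|^6, that is, if eta = 0.  Hence
    eta V^* never meets the boundaries of the sectors which separate the sheets. *)
Lemma upper_Re_cube P : curve P -> upper P -> heta P != 0 ->
  0 < Re ((heta P * (hV P)^*) ^+ 3).
Proof.
move=> hP hu he; case: (hP) => h1 h2 h3.
set w := heta P * (hV P)^*.
have e27 : 27 * w ^+ 3 = (nsq (hV P) ^+ 3)%:C + (hU P * (hV P)^*) ^+ 3.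
  rewrite /w exprMn h2 mulrA (res_cubes h1) rmorphXn /= nsqE -/(hU P) -/(hV P).
  by rewrite !exprMn; ring.
have V0 := upper_V_neq0 hP hu.
set z := (hU P * (hV P)^*) ^+ 3 in e27.
have hz : nsq z <= (nsq (hV P) ^+ 3) ^+ 2.
  rewrite /z nsqX nsqM nsqJ exprMn -exprM (exprD _ 3 3) ler_wpM2r ?exprn_ge0 ?nsq_ge0 //.
  by rewrite lerXn2r ?nnegrE ?nsq_ge0.
have : 27 * Re (w ^+ 3) = nsq (hV P) ^+ 3 + Re z.
  by have := congr1 (@complex.Re _) e27; rewrite ReM Ren Imn mul0r subr0 ReD.
have N0 : 0 <= nsq (hV P) ^+ 3 by rewrite exprn_ge0 ?nsq_ge0.
move: (nsq (hV P) ^+ 3) e27 hz N0 => N e27 hz N0 hr.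
rewrite ltNge; apply/negP => hneg.
have rz : Re z = - N.
  have : Re z <= - N by lra.
  by move: hz; rewrite /nsq; nra.
have iz : Im z = 0.
  by move: hz; rewrite /nsq rz sqrrN gerDl => hz; apply/eqP;
    rewrite -sqrf_eq0 eq_le hz sqr_ge0.
have : w ^+ 3 = 0.
  apply: (@mulfI _ 27); first by rewrite pnatr_eq0.
  by rewrite mulr0 e27; apply: eqC; rewrite ?ReD ?ImD /= ?rz ?iz ?addrN ?addr0.
move/eqP; rewrite expf_eq0 /= mulf_eq0 (negPf he) conjc_eq0 /=; exact/negP.
Qed.

End Cubic.

(** * The curve is a torus *)

Section Correspondence.
Variable R : realType.
Implicit Types (P Q : hpt R) (g : bool * nat).

Local Notation omega := (omega R).

Lemma nsq_le0 (w : R[i]) : nsq w <= 0 -> w = 0.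
Proof. by move=> h; apply/eqP; rewrite -nsq_eq0 eq_le h nsq_ge0. Qed.

Lemma iter_rotE n P : iter n (@rotE R) P = iter (n %% 3) (@rotE R) P.
Proof.
by apply: (@iter_r_mod _ _ (fun _ => True)) => // Q _; exact: rotE3.
Qed.

Lemma iter_rot_eta0 n P : heta P = 0 -> iter n (@rotE R) P = P.
Proof.
by case: P => x y z t /= ->; elim: n => //= n ->; rewrite /rotE /= mulr0.
Qed.

Lemma omega_mod n : omega ^+ n = omega ^+ (n %% 3).
Proof. by rewrite {1}(divn_eq n 3) exprD mulnC exprM omega3 expr1n mul1r. Qed.

Lemma upper_cover P : upper P -> exists n, fund (iter n (@rotE R) P).
Proof.
move=> hu; have [n hn] := sector_rotate (heta P * (hV P)^*).
by exists n; rewrite /fund eta_rot hV_rot -mulrA hn andbT /upper hU_rot hV_rot.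
Qed.

Lemma fund_cover P : exists g, fund (actE g P).
Proof.
have [hu|hl] := boolP (upper P).
  by have [n hn] := upper_cover hu; exists (false, n).
have hu : upper (flipE P).
  by rewrite /upper hU_flip hV_flip !nsqJ ltW // ltNge.
by have [n hn] := upper_cover hu; exists (true, n).
Qed.

(** Two distinct rotates of a number can lie in the sector only on its two boundary
    rays, whose points have non-positive cubes. *)
Lemma sector_overlap n (w : R[i]) : (n %% 3 != 0)%N -> sector w ->
  sector (omega ^+ n * w) -> Re (w ^+ 3) <= 0.
Proof.
have o2 := omega2E R; rewrite omega_mod => hn hw; have : (n %% 3 < 3)%N by rewrite ltn_mod.
case: (n %% 3)%N hn => [|[|[|//]]] // _ _ /sectorP.
- rewrite expr1 (_ : omega ^+ 2 * (omega * w) = w); last by ring: o2.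
  case/sectorP: hw => h1 h2 [h3 h4].
  have a0 : 0 <= Re w.
    move: h1 h2; rewrite omega_sq !ReImE /omega /=; lra.
  have : Re (omega * w) = Re w by apply/le_anti; rewrite h1.
  rewrite Re_cube !ReImE /omega /=; have h3' := @sqrt3_sq R.
  set s := Num.sqrt 3 in h3' *; move=> hb.
  have : (s * Im w) ^+ 2 = (- (3 * Re w)) ^+ 2 by congr (_ ^+ 2); lra.
  rewrite !exprMn h3'; nra.
- rewrite (_ : omega * (omega ^+ 2 * w) = w); last by ring: o2.
  case/sectorP: hw => h1 h2 [h3 h4].
  have a0 : 0 <= Re w.
    move: h1 h2; rewrite omega_sq !ReImE /omega /=; lra.
  have : Re (omega ^+ 2 * w) = Re w by apply/le_anti; rewrite h2.
  rewrite Re_cube omega_sq !ReImE /omega /=; have h3' := @sqrt3_sq R.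
  set s := Num.sqrt 3 in h3' *; move=> hb.
  have : (s * Im w) ^+ 2 = (3 * Re w) ^+ 2 by congr (_ ^+ 2); lra.
  rewrite !exprMn h3'; nra.
Qed.

Lemma fund_rot_eta n P : curve P -> (n %% 3 != 0)%N -> fund P ->
  fund (iter n (@rotE R) P) -> heta P = 0.
Proof.
move=> hP hn /andP[hu hs] /andP[_]; rewrite hV_rot eta_rot -mulrA => hs2.
apply/eqP; apply/negPn/negP => he.
by have := sector_overlap hn hs hs2; rewrite leNgt upper_Re_cube.
Qed.

Lemma sector_scale (l : R) (w : R[i]) : 0 < l -> sector (l%:C * w) = sector w.
Proof.
move=> l0; rewrite /sector !ReImE /= !mul0r subr0 addr0 pmulr_rge0 //.
by rewrite !exprMn [3 * (_ * _)]mulrCA ler_pM2l // exprn_gt0.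
Qed.

Lemma narrow_conj (w : R[i]) : narrow w^* = narrow w.
Proof. by rewrite /narrow ReJ ImJ sqrrN. Qed.

(** If P and its image under a reflection lie in the fundamental domain, then |U| <= |V|
    holds for both, whence |U| = |V|; and eta V^* and the corresponding product
    omega^n eta^* U for the image have arguments in [-pi/6, pi/6], which locates the
    argument of U V^*. *)
Lemma fund_flip_arc n P : curve P -> heta P != 0 -> fund P ->
  fund (actE (true, n) P) -> nsq (hU P) = nsq (hV P) /\
  sector (omega ^+ n * (hU P * (hV P)^*)).
Proof.
move=> hP he /andP[hu hs] hf.
have hP' : curve (actE (true, n) P) by exact: curve_act.
have he' : heta (actE (true, n) P) = omega ^+ n * (heta P)^* by rewrite /actE /dih /= eta_rot.
have hV' : hV (actE (true, n) P) = (hU P)^* by rewrite /actE /dih /= hV_rot hV_flip.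
have hU' : hU (actE (true, n) P) = (hV P)^* by rewrite /actE /dih /= hU_rot hU_flip.
case/andP: (hf) => hu' hs'.
have e1 : nsq (hU P) = nsq (hV P).
  apply/le_anti/andP; split; first exact: hu.
  by move: hu'; rewrite /upper hU' hV' !nsqJ.
split=> //.
have n1 : narrow (heta P * (hV P)^*) by apply: sector_narrow => //; rewrite ltW // upper_Re_cube.
have n2 : narrow (heta (actE (true, n) P) * (hV (actE (true, n) P))^*).
  apply: sector_narrow => //; rewrite ltW // upper_Re_cube // he' mulf_neq0 ?conjc_eq0 //.
  by rewrite expf_neq0 // omega_neq0.
rewrite -narrow_conj in n2; have := narrow_sector n1 n2.
rewrite conjcK he' hV' conjcK.
rewrite (_ : _ * _ * _ = (nsq (heta P))%:C * (omega ^+ n * (hU P * (hV P)^*))).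
  by rewrite sector_scale // nsq_gt0.
by rewrite nsqE; ring.
Qed.

(** A point of the fundamental domain which an element g sends into the fundamental
    domain has barycentric coordinates on the face of the triangle which g fixes on the
    torus.  This makes Phi well defined. *)
Lemma fund_act_alcove g P : curve P -> fund P -> fund (actE g P) ->
  actT g (alcove (bary P)) = alcove (bary P).
Proof.
move=> hP hf hg.
have hT := alcove_torus (bary P); have hS := bary_simplex hP.
have [he|he] := eqVneq (heta P) 0.
  by apply: alcove_vertex_fixed => //; apply/vertex_eta.
case: g hg => -[] n hg; last first.
  have [hn|hn] := eqVneq (n %% 3)%N 0%N.
    by rewrite /actT /dih /= iter_rotT // hn.
  by move/eqP: he; case; apply: (fund_rot_eta hP hn hf hg).
have [e1 e2] := fund_flip_arc hP he hf hg.
case: (hP) => h1 _ _; have L := perim_gt0 hP.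
have [f0 f1 f2] := alcove_edge_fixed hS.
rewrite /actT /dih /= iter_rotT; last exact: flipT_torus.
move: e2; rewrite omega_mod; have : (n %% 3 < 3)%N by rewrite ltn_mod.
case: (n %% 3)%N => [|[|[|//]]] _ /=.
- rewrite expr0 mul1r => e2; apply: f0.
  by rewrite /= -(res_arc h1 e1 e2) subrr mul0r.
- rewrite expr1 => e2; apply: f2.
  have h1' : hz P + hx P + hy P = 0 by rewrite -h1; ring.
  rewrite /= -(@res_arc _ _ _ _ h1') ?subrr ?mul0r //.
    by rewrite 2!nsq_resU_rot 2!nsq_resV_rot.
  rewrite (_ : resU _ _ _ * _ = omega * (hU P * (hV P)^*)) //.
  rewrite 2!resU_rot 2!resV_rot -/(hU P) -/(hV P) !(conjcM, conjcX) omegaJ.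
  by ring: (omega2E R).
- move=> e2; apply: f1.
  have h1' : hy P + hz P + hx P = 0 by rewrite -h1; ring.
  rewrite /= -(@res_arc _ _ _ _ h1') ?subrr ?mul0r //.
    by rewrite nsq_resU_rot nsq_resV_rot.
  rewrite (_ : resU _ _ _ * _ = omega ^+ 2 * (hU P * (hV P)^*)) //.
  rewrite resU_rot resV_rot -/(hU P) -/(hV P) !(conjcM, conjcX) omegaJ.
  by ring: (omega2E R).
Qed.

Lemma scale_scale l l' P : scale l (scale l' P) = scale (l * l') P.
Proof. by rewrite /scale /= !mulrA. Qed.

Lemma bary_scale l P : l != 0 -> bary (scale l P) = bary P.
Proof.
move=> l0; have c0 : cmod l != 0 by rewrite cmod_eq0.
rewrite /bary /perim /= !cmodM -!mulrDr -!mulrBr.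
by congr (_, _, _); rewrite invfM mulrACA mulfV // mul1r.
Qed.

Lemma fund_scale l P : l != 0 -> fund (scale l P) = fund P.
Proof.
move=> l0; rewrite /fund /upper hU_scale hV_scale !nsqM /= ler_pM2l ?nsq_gt0 //.
congr (_ && _); rewrite conjcM mulrACA -nsqE sector_scale // nsq_gt0 //.
Qed.

Lemma res_scale_eq (l : R[i]) P Q : curve P -> curve Q ->
  hU Q = l * hU P -> hV Q = l * hV P ->
  [/\ hx Q = l * hx P, hy Q = l * hy P & hz Q = l * hz P].
Proof.
move=> [p _ _] [q _ _] eU eV.
have n3 : (3 : R[i]) != 0 by rewrite pnatr_eq0.
split; apply: (mulfI n3).
- by rewrite (res0 q) -/(hU Q) -/(hV Q) eU eV [RHS]mulrCA (res0 p) -/(hU P) -/(hV P); ring.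
- by rewrite (res1 q) -/(hU Q) -/(hV Q) eU eV [RHS]mulrCA (res1 p) -/(hU P) -/(hV P); ring.
- by rewrite (res2 q) -/(hU Q) -/(hV Q) eU eV [RHS]mulrCA (res2 p) -/(hU P) -/(hV P); ring.
Qed.

(** A positively oriented triangle is determined up to similarity by the ratios of
    its side lengths: these give U V^* and |U|^2 + |V|^2 up to a common positive
    factor, and |U| <= |V|. *)
Lemma fund_bary_inj P Q : curve P -> curve Q -> fund P -> fund Q ->
  bary P = bary Q -> exists2 l, l != 0 & Q = scale l P.
Proof.
move=> hP0 hQ fP0 fQ hb0.
wlog eL : P hP0 fP0 hb0 / perim P = perim Q => [hw|].
  pose t := perim Q / perim P.
  have t0 : 0 < t by rewrite divr_gt0 ?perim_gt0.
  have tC : t%:C != 0 by rewrite -cmod_gt0 cmod_real // ltW.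
  have [||||l l0 ->] := hw (scale t%:C P).
  - exact: curve_scale.
  - by rewrite fund_scale.
  - by rewrite bary_scale.
  - rewrite /perim /= !cmodM -!mulrDr cmod_real ?ltW // /t mulfVK //.
    by rewrite gt_eqF // perim_gt0.
  by exists (l * t%:C); rewrite ?mulf_neq0 // scale_scale.
have hP := hP0; have fP := fP0; have hb := hb0.
have L := perim_gt0 hP; have Ln := lt0r_neq0 L.
case: (hP) => p1 p2 p3; case: (hQ) => q1 q2 q3.
have [e1 e2 e3] : [/\ nsq (hx P) = nsq (hx Q), nsq (hy P) = nsq (hy Q) &
   nsq (hz P) = nsq (hz Q)].
  move: hb; rewrite /bary eL => -[].
  have Ln' : (perim Q)^-1 != 0 by rewrite -eL invr_neq0.
  move=> /(mulIf Ln') b1 /(mulIf Ln') b2 /(mulIf Ln') b3.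
  move: eL; rewrite /perim -!cmodX2 => eL.
  by split; congr (_ ^+ 2); lra.
have eM : hU P * (hV P)^* = hU Q * (hV Q)^*.
  by rewrite (res_prod p1) (res_prod q1) e1 e2 e3.
have eS : nsq (hU P) + nsq (hV P) = nsq (hU Q) + nsq (hV Q).
  by rewrite (res_sum_sq p1) (res_sum_sq q1) e1 e2 e3.
have eMs : nsq (hU P) * nsq (hV P) = nsq (hU Q) * nsq (hV Q).
  by have := congr1 (@nsq R) eM; rewrite !nsqM !nsqJ.
case/andP: fP => uP sP; case/andP: fQ => uQ sQ.
have eV : nsq (hV P) = nsq (hV Q).
  have : (nsq (hV P) - nsq (hU P)) ^+ 2 = (nsq (hV Q) - nsq (hU Q)) ^+ 2.
    transitivity ((nsq (hU P) + nsq (hV P)) ^+ 2 - 4 * (nsq (hU P) * nsq (hV P))); first by ring.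
    by rewrite eS eMs; ring.
  move/eqP; rewrite eqrXn2 ?subr_ge0 // => /eqP; lra.
have VP := upper_V_neq0 hP uP; have VQ := upper_V_neq0 hQ uQ.
pose l := hV Q / hV P.
have lV : hV Q = l * hV P by rewrite divfK.
have l0 : l != 0 by rewrite mulf_neq0 // invr_neq0.
have lU : hU Q = l * hU P.
  apply: (@mulIf _ ((hV Q)^* * hV P)); first by rewrite mulf_neq0 ?conjc_eq0.
  transitivity (hU P * (nsq (hV P))%:C); first by rewrite nsqE [LHS]mulrA -eM; ring.
  by rewrite eV nsqE /l; field.
have [ex ey ez] := res_scale_eq hP hQ lU lV.
have [k hk] : exists k : 'I_3, heta Q = omega ^+ k * (l * heta P).
  apply: cube_eq; rewrite exprMn p2 q2 ex ey ez; ring.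
have hQ' : Q = scale l (iter k (@rotE R) P).
  have -> : iter k (@rotE R) P = Hpt (hx P) (hy P) (hz P) (omega ^+ k * heta P).
    elim: (nat_of_ord k) => [|n IH]; first by rewrite expr0 mul1r; case: (P).
    by rewrite iterS IH /rotE /= exprS mulrA.
  case: (Q) ex ey ez hk => [x y z t] /= -> -> -> ->.
  by rewrite /scale /=; congr Hpt; ring.
have [hk0|hk0] := eqVneq (k %% 3)%N 0%N.
  by exists l => //; rewrite hQ' iter_rotE hk0.
have he : heta P = 0.
  by apply: (fund_rot_eta hP hk0) => //; rewrite -(fund_scale _ l0) -hQ'; apply/andP.
by exists l => //; rewrite hQ' iter_rot_eta0.
Qed.


(** A triangle with sides of lengths a, b, c is drawn with its first side on the real
    axis; p and q are the coordinates of the second side, by the law of cosines. *)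
Lemma bary_surj (m : R * R * R) : simplex m -> exists2 P, curve P & bary P = m.
Proof.
case: m => [[m0 m1] m2]; rewrite /simplex /= => -[g0 g1 g2 gs].
pose a := (m1 + m2) / 2; pose b := (m2 + m0) / 2; pose c := (m0 + m1) / 2.
have sabc : a + b + c = 1 by rewrite /a /b /c; lra.
have [a0 b0 c0] : [/\ 0 <= a, 0 <= b & 0 <= c] by rewrite /a /b /c; split; lra.
suff [x [y [z [h ha hb hc]]]] : exists x y z : R[i],
    [/\ x + y + z = 0, cmod x = a, cmod y = b & cmod z = c].
  have [t ht] := cube_root_exists (x * y * z).
  exists (Hpt x y z t).
    split=> //= -[ex ey]; move: h ha hb hc; rewrite ex ey !add0r => ->.
    by rewrite cmod0; lra.
  rewrite /bary /perim /= ha hb hc sabc !divr1; congr (_, _, _); rewrite /a /b /c; lra.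
have [ea|na] := eqVneq a 0.
  exists 0, (b%:C), (- b%:C); rewrite cmod0 cmodN !cmod_real //; split; rewrite ?addr0 ?add0r ?subrr //.
  rewrite /a in ea; rewrite /b /c; lra.
have pa : 0 < a by rewrite lt_def na.
pose p := (a ^+ 2 + b ^+ 2 - c ^+ 2) / (2 * a).
have hp : 2 * a * p = a ^+ 2 + b ^+ 2 - c ^+ 2.
  by rewrite /p mulrCA mulfV ?mulr1 // mulf_neq0 // pnatr_eq0.
have hq : 0 <= b ^+ 2 - p ^+ 2.
  have t1 : c <= a + b by rewrite /a /b /c; lra.
  have t2 : a <= b + c by rewrite /a /b /c; lra.
  have t3 : b <= c + a by rewrite /a /b /c; lra.
  have p1 : p <= b.
    rewrite -(ler_pM2l (mulr_gt0 (@ltr0Sn R 1) pa)) hp.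
    have : 0 <= (c - (a - b)) * (c + (a - b)) by rewrite mulr_ge0 //; lra.
    lra.
  have p2 : - b <= p.
    rewrite -(ler_pM2l (mulr_gt0 (@ltr0Sn R 1) pa)) hp.
    have : 0 <= (a + b - c) * (a + b + c) by rewrite mulr_ge0 //; lra.
    lra.
  have : 0 <= (b - p) * (b + p) by rewrite mulr_ge0; lra.
  lra.
pose q := Num.sqrt (b ^+ 2 - p ^+ 2).
have q2 : q ^+ 2 = b ^+ 2 - p ^+ 2 by rewrite sqr_sqrtr.
have sq (w : R[i]) r : 0 <= r -> nsq w = r ^+ 2 -> cmod w = r.
  by move=> r0; rewrite /cmod => ->; rewrite sqrtr_sqr ger0_norm.
exists (- a%:C), (p +i* q), ((a - p) +i* (- q)); split.
- by apply: eqC; rewrite !ReImE /=; lra.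
- by rewrite cmodN cmod_real.
- by apply: sq => //; rewrite /nsq /= q2; lra.
- by apply: sq => //; rewrite /nsq /= sqrrN q2; lra.
Qed.

(** ** The homeomorphism on points *)

Lemma actT_quot g h (t : R[i] * R[i]) : on_torus t ->
  actT h t = actT (dih_quot g h) (actT g t).
Proof. exact: (dih_quotP (@rotT_torus R) (@flipT_torus R) (@rotT3 R) (@flipTK R) (@flipT_rotT R)). Qed.

Lemma actE_quot g h P : actE h P = actE (dih_quot g h) (actE g P).
Proof.
by apply: (@dih_quotP _ _ _ (fun _ => True)) => // Q _;
  [exact: rotE3|exact: flipEK|exact: flipE_rotE].
Qed.

Lemma actT_torus g (t : R[i] * R[i]) : on_torus t -> on_torus (actT g t).
Proof. exact: (dih_stable (@rotT_torus R) (@flipT_torus R)). Qed.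

Lemma actT_inj g (t u : R[i] * R[i]) : on_torus t -> on_torus u ->
  actT g t = actT g u -> t = u.
Proof. exact: (dih_inj (@rotT_torus R) (@flipT_torus R) (@rotT3 R) (@flipTK R) (@flipT_rotT R)). Qed.

Lemma actT_invK g (t : R[i] * R[i]) : on_torus t -> actT g (actT (dih_inv g) t) = t.
Proof. exact: (dihKV (@rotT_torus R) (@flipT_torus R) (@rotT3 R) (@flipTK R) (@flipT_rotT R)). Qed.

Lemma actE_invK g P : actE g (actE (dih_inv g) P) = P.
Proof.
by apply: (@dihKV _ _ _ (fun _ => True)) => // Q _;
  [exact: rotE3|exact: flipEK|exact: flipE_rotE].
Qed.

Lemma actE_inj g P Q : actE g P = actE g Q -> P = Q.
Proof.
by apply: (@dih_inj _ _ _ (fun _ => True)) => // S _;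
  [exact: rotE3|exact: flipEK|exact: flipE_rotE].
Qed.

(** An element which fixes the point of the torus fixes the point of the curve: it
    preserves positive orientation, since a reflection fixes only flat triangles; a
    further rotation brings the image into the fundamental domain, and by
    fund_act_alcove this rotation fixes the point of the torus too, so that it is trivial
    unless eta = 0.  This makes Phi injective. *)
Lemma alcove_fixed_fund g P : curve P -> fund P ->
  actT g (alcove (bary P)) = alcove (bary P) ->
  exists2 l, l != 0 & actE g P = scale l P.
Proof.
move=> hP hf hg; have hS := bary_simplex hP.
have hQ : curve (actE g P) by exact: curve_act.
suff hfQ : fund (actE g P).
  by apply: fund_bary_inj => //; rewrite bary_act.
have hu : upper (actE g P).
  case/andP: hf => hu hs.
  case: g hg {hQ} => -[] n hg; rewrite /actE /dih /= /upper hU_rot hV_rot //.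
  rewrite hU_flip hV_flip !nsqJ (edge_degenerate hP) //.
  exact: alcove_flip_fixed hg.
have [n hn] := upper_cover hu.
have fixn : iter n (@rotT R) (alcove (bary P)) = alcove (bary P).
  have := @fund_act_alcove (g.1, (n + g.2)%N) P hP hf.
  by rewrite {1}/actE {1}/actT /dih /= !iterD => /(_ hn); rewrite -[X in iter n _ X]/(actT g _) hg.
have [hn0|hn0] := eqVneq (n %% 3)%N 0%N; first by move: hn; rewrite iter_rotE hn0.
have he : heta P = 0 by apply/(vertex_eta hP); exact: alcove_rot_fixed hn0 fixn.
suff e0 : heta (actE g P) = 0 by move: hn; rewrite iter_rot_eta0.
by case: (g) => -[] j; rewrite /actE /dih /= eta_rot /= he ?conjc0 mulr0.
Qed.

(** The graph of Phi: an element g which brings P into the fundamental domain brings its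
    image to the point of the alcove with the same barycentric coordinates. *)
Definition corresp P (t : R[i] * R[i]) := on_torus t /\
  exists2 g, fund (actE g P) & actT g t = alcove (bary P).

Definition Phi P : R[i] * R[i] := xget (1, 1) (corresp P).

Lemma corresp_fun P t u : curve P -> corresp P t -> corresp P u -> t = u.
Proof.
move=> hP [ht [g fg eg]] [hu [h fh eh]].
apply: (@actT_inj h) => //; rewrite eh (actT_quot g h ht) eg -(bary_act g).
apply: fund_act_alcove => //; first exact: curve_act.
by rewrite -actE_quot.
Qed.

Lemma corresp_ex P : curve P -> exists t, corresp P t.
Proof.
move=> hP; have [g hg] := fund_cover P.
exists (actT (dih_inv g) (alcove (bary P))); split.
  by apply: actT_torus; exact: alcove_torus.
by exists g => //; rewrite actT_invK //; exact: alcove_torus.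
Qed.

Lemma PhiP P : curve P -> corresp P (Phi P).
Proof. by move=> /corresp_ex[t ht]; rewrite /Phi; case: xgetP => [u -> //|/(_ t)]. Qed.

Lemma Phi_eq P t : curve P -> corresp P t -> Phi P = t.
Proof. by move=> hP ht; apply: corresp_fun hP (PhiP hP) ht. Qed.

Lemma Phi_torus P : curve P -> on_torus (Phi P).
Proof. by move=> /PhiP[]. Qed.

Lemma Phi_scale l P : l != 0 -> curve P -> Phi (scale l P) = Phi P.
Proof.
move=> l0 hP; apply: Phi_eq; first exact: curve_scale.
have [ht [g fg eg]] := PhiP hP; split=> //; exists g; last by rewrite bary_scale.
by have [l' l'0 ->] := actE_scale g P l0; rewrite fund_scale.
Qed.

Lemma Phi_inj P Q : curve P -> curve Q -> Phi P = Phi Q ->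
  exists2 l, l != 0 & Q = scale l P.
Proof.
move=> hP hQ e; have [ht [g fg eg]] := PhiP hP; have [hu [h fh eh]] := PhiP hQ.
rewrite -e in eh.
have ek : actT (dih_quot g h) (alcove (bary P)) = alcove (bary Q).
  by rewrite -eg -actT_quot.
have eb : bary P = bary Q.
  by apply: alcove_inj ek; exact: bary_simplex.
have hgP : curve (actE g P) by exact: curve_act.
have [|l l0 el] := alcove_fixed_fund (g := dih_quot g h) hgP fg.
  by rewrite bary_act ek eb.
rewrite -actE_quot in el.
have [|l' l'0 el'] := fund_bary_inj hgP (curve_act h hQ) fg fh.
  by rewrite !bary_act.
have : actE h Q = scale (l' / l) (actE h P).
  by rewrite el el' scale_scale divfK.
have c0 : l' / l != 0 by rewrite mulf_neq0 // invr_neq0.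
have [c' c'0 ec'] := actE_scale (dih_inv h) (actE h P) c0.
move=> eQ; exists c' => //; apply: (@actE_inj h); rewrite eQ.
rewrite -[scale _ (actE h P)](actE_invK h) ec'; congr (actE h (scale _ _)).
by apply: (@actE_inj h); rewrite actE_invK.
Qed.

Lemma Phi_surj t : on_torus t -> exists2 P, curve P & Phi P = t.
Proof.
move=> ht; have [g [m hm hg]] := alcove_cover ht.
have [P hP em] := bary_surj hm; have [h hh] := fund_cover P.
exists (actE (dih_inv g) (actE h P)); first by do 2!apply: curve_act.
apply: Phi_eq; first by do 2!apply: curve_act.
by split=> //; exists g; rewrite ?actE_invK // !bary_act em.
Qed.

End Correspondence.

(** * Limits in the complex plane *)

Section Limits.
Variable R : realType.

(** Limits in R[i] are taken in R[i]^o, which carries the norm topology. *)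
Definition cvgC (T : Type) (F : set_system T) (f : T -> R[i]) (a : R[i]) : Prop :=
  (f : T -> Cplx R) @ F --> (a : Cplx R).

Definition cvgR (T : Type) (F : set_system T) (f : T -> R) (a : R) : Prop :=
  f @ F --> a.

Section Filter.
Variables (T : Type) (F : set_system T) (FF : Filter F).
Implicit Types (f g : T -> R[i]) (a b : R[i]) (r s : T -> R).

Lemma cvgCP f a : cvgC F f a <->
  forall eps : R, 0 < eps -> \forall x \near F, cmod (a - f x) < eps.
Proof.
split=> [/cvgrPdist_lt h e e0|h].
  have e0' : 0 < e%:C by rewrite ltcR.
  apply: filterS (h _ e0') => x; rewrite cmodE ltcR; exact.
apply/cvgrPdist_lt => -[e e'] /=; rewrite ltcE /= => /andP[/eqP e'0 e0].
apply: filterS (h _ e0) => x hx; rewrite cmodE ltcE /= e'0 eqxx //.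
Qed.

Lemma cvgRP r (a : R) : cvgR F r a <->
  forall eps : R, 0 < eps -> \forall x \near F, `|a - r x| < eps.
Proof. exact: cvgrPdist_lt. Qed.

Lemma cvgC_mul f g a b : cvgC F f a -> cvgC F g b ->
  cvgC F (fun x => f x * g x) (a * b).
Proof.
by move=> hf hg; apply: (@cvgM R[i] T F FF (f : T -> R[i]^o) (g : T -> R[i]^o) a b hf hg).
Qed.

Lemma cvgC_add f g a b : cvgC F f a -> cvgC F g b ->
  cvgC F (fun x => f x + g x) (a + b).
Proof.
by move=> hf hg; apply: (@cvgD R[i] R[i]^o T F FF (f : T -> R[i]^o) (g : T -> R[i]^o) a b hf hg).
Qed.

Lemma cvgC_opp f a : cvgC F f a -> cvgC F (fun x => - f x) (- a).
Proof. by move=> hf; apply: (@cvgN R[i] R[i]^o T F FF (f : T -> R[i]^o) a hf). Qed.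

Lemma cvgC_sub f g a b : cvgC F f a -> cvgC F g b ->
  cvgC F (fun x => f x - g x) (a - b).
Proof. by move=> hf hg; apply: cvgC_add hf (cvgC_opp hg). Qed.

Lemma cvgC_inv f a : a != 0 -> cvgC F f a -> cvgC F (fun x => (f x)^-1) (a^-1).
Proof.
by move=> a0 hf; apply: (@cvgV R[i] T F FF (f : T -> R[i]^o) a a0 hf).
Qed.

Lemma cvgC_cst a : cvgC F (fun _ => a) a.
Proof. exact: cvg_cst. Qed.

Lemma cvgC_exp f a n : cvgC F f a -> cvgC F (fun x => f x ^+ n) (a ^+ n).
Proof.
move=> h; elim: n => [|n IH]; first exact: cvgC_cst.
rewrite exprS (_ : (fun _ => _) = (fun x => f x * f x ^+ n)); first exact: cvgC_mul.
by apply/funext => x; rewrite exprS.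
Qed.

Lemma cvgR_add r s (a b : R) : cvgR F r a -> cvgR F s b ->
  cvgR F (fun x => r x + s x) (a + b).
Proof. by move=> hf hg; apply: (@cvgD R R T F FF r s a b hf hg). Qed.

Lemma cvgR_opp r (a : R) : cvgR F r a -> cvgR F (fun x => - r x) (- a).
Proof. by move=> hf; apply: (@cvgN R R T F FF r a hf). Qed.

Lemma cvgR_sub r s (a b : R) : cvgR F r a -> cvgR F s b ->
  cvgR F (fun x => r x - s x) (a - b).
Proof. by move=> hf hg; apply: cvgR_add hf (cvgR_opp hg). Qed.

Lemma cvgR_mul r s (a b : R) : cvgR F r a -> cvgR F s b ->
  cvgR F (fun x => r x * s x) (a * b).
Proof. by move=> hf hg; apply: (@cvgM R T F FF r s a b hf hg). Qed.

Lemma cvgR_inv r (a : R) : a != 0 -> cvgR F r a -> cvgR F (fun x => (r x)^-1) (a^-1).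
Proof. by move=> a0 hf; apply: (@cvgV R T F FF r a a0 hf). Qed.

Lemma cvgR_cst (a : R) : cvgR F (fun _ => a) a.
Proof. exact: cvg_cst. Qed.

Lemma cvgR_comp (h : R -> R) r (a : R) : continuous h -> cvgR F r a ->
  cvgR F (fun x => h (r x)) (h a).
Proof. by move=> hc hr; exact: (@continuous_cvg _ _ _ F FF r h a (hc a) hr). Qed.

Lemma cvgC_lip (h : R[i] -> R) f a :
  (forall z w, `|h z - h w| <= cmod (z - w)) ->
  cvgC F f a -> cvgR F (fun x => h (f x)) (h a).
Proof.
move=> hh /cvgCP hf; apply/cvgRP => e e0.
by apply: filterS (hf _ e0) => x; apply: le_lt_trans.
Qed.

Lemma cvgC_Re f a : cvgC F f a -> cvgR F (fun x => Re (f x)) (Re a).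
Proof. by apply: cvgC_lip => z w; rewrite -ReN -ReD; exact: Re_le_cmod. Qed.

Lemma cvgC_Im f a : cvgC F f a -> cvgR F (fun x => Im (f x)) (Im a).
Proof. by apply: cvgC_lip => z w; rewrite -ImN -ImD; exact: Im_le_cmod. Qed.

Lemma cvgC_cmod f a : cvgC F f a -> cvgR F (fun x => cmod (f x)) (cmod a).
Proof.
apply: cvgC_lip => z w; rewrite ler_norml; apply/andP; split.
  by rewrite lerNl opprB lerBlDr cmodB; have := cmodD (w - z) z; rewrite subrK.
by rewrite lerBlDr; have := cmodD (z - w) w; rewrite subrK.
Qed.

Lemma cvgC_conj f a : cvgC F f a -> cvgC F (fun x => (f x)^*) a^*.
Proof.
move=> /cvgCP hf; apply/cvgCP => e e0.
by apply: filterS (hf _ e0) => x; rewrite -conjcN -conjcD cmodJ.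
Qed.

Lemma cvgC_ReIm r s (a b : R) : cvgR F r a -> cvgR F s b ->
  cvgC F (fun x => r x +i* s x) (a +i* b).
Proof.
move=> /cvgRP hr /cvgRP hs; apply/cvgCP => e e0.
have e2 : 0 < e / 2 by rewrite divr_gt0.
apply: filterS2 (hr _ e2) (hs _ e2) => x h1 h2.
apply: le_lt_trans (cmod_le_ReIm _) _ => /=; lra.
Qed.

Lemma cvgC_real r (a : R) : cvgR F r a -> cvgC F (fun x => (r x)%:C) a%:C.
Proof. by move=> h; apply: cvgC_ReIm => //; exact: cvgR_cst. Qed.

Lemma cvgC_nsq f a : cvgC F f a -> cvgR F (fun x => nsq (f x)) (nsq a).
Proof.
move=> h; rewrite /nsq !expr2; apply: cvgR_add; apply: cvgR_mul;
  solve [exact: cvgC_Re | exact: cvgC_Im].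
Qed.

Lemma cvgC_e r (a : R) : cvgR F r a -> cvgC F (fun x => e (r x)) (e a).
Proof.
move=> h; have h2 : cvgR F (fun x => 2 * pi * r x) (2 * pi * a).
  by apply: cvgR_mul => //; exact: cvgR_cst.
by apply: cvgC_ReIm; apply: cvgR_comp h2; [exact: continuous_cos|exact: continuous_sin].
Qed.

(** By narrow_cube_dist, crt is Hoelder of exponent 1/3 on the right half-plane. *)
Lemma cvgC_crt f a : 0 <= Re a -> (\forall x \near F, 0 <= Re (f x)) ->
  cvgC F f a -> cvgC F (fun x => crt (f x)) (crt a).
Proof.
move=> a0 f0 /cvgCP h; apply/cvgCP => e e0.
have e3 : 0 < e ^+ 3 by rewrite exprn_gt0.
apply: filterS2 f0 (h _ e3) => x fx0 hx.
have := narrow_cube_dist (crt_narrow a0) (crt_narrow fx0); rewrite !crtK => hn.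
have : (cmod (crt a - crt (f x)) ^+ 3) ^+ 2 < (e ^+ 3) ^+ 2.
  rewrite exprAC cmodX2; apply: le_lt_trans hn _.
  by rewrite -cmodX2 ltrXn2r // ?nnegrE ?cmod_ge0 ?(ltW e3).
by rewrite -!exprM ltr_pXn2r // ?nnegrE ?cmod_ge0 ?(ltW e0).
Qed.

Lemma cvgR_gt0 r (a : R) : cvgR F r a -> 0 < a -> \forall x \near F, 0 < r x.
Proof.
move=> /cvgRP h a0; apply: filterS (h _ a0) => x.
by rewrite ltr_norml => /andP[]; lra.
Qed.

Lemma cvgC_neq0 f a : cvgC F f a -> a != 0 -> \forall x \near F, f x != 0.
Proof.
move=> /cvgC_nsq h a0; have := cvgR_gt0 h; rewrite nsq_gt0 => /(_ a0).
by apply: filterS => x; rewrite nsq_gt0.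
Qed.

End Filter.

Section Within.
Variable T : topologicalType.
Implicit Types (A B : set T) (f g : T -> R[i]).

Definition contC A f := forall x, A x -> cvgC (within A (nbhs x)) f (f x).

Lemma contC_within A f : contC A f -> {within A, continuous (f : T -> Cplx R)}.
Proof. by move=> h; apply/subspace_continuousP. Qed.

Lemma contC_within2 A f g : contC A f -> contC A g ->
  {within A, continuous (fun x => (f x, g x) : Cplx R * Cplx R)}.
Proof.
move=> hf hg; apply/subspace_continuousP => x Ax.
exact: (@cvg_pair T (Cplx R) (Cplx R) (within A (nbhs x)) (nbhs (f x : Cplx R))
  (nbhs (g x : Cplx R)) _ _ _ f g (hf x Ax) (hg x Ax)).
Qed.

Lemma contC_closed0 A f : closed A -> contC A f -> closed (A `&` [set x | f x = 0]).
Proof.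
move=> cA hf x hx; have Ax : A x by apply: cA; apply: closureS hx => y [].
split=> //=; apply/eqP/negPn/negP => fx.
have := cvgC_neq0 _ (hf x Ax) fx => /(_ _).
move=> H; have {}H : \forall y \near within A (nbhs x), f y != 0 by apply: H.
by have [y [[Ay fy] /(_ Ay)]] := hx _ H; rewrite fy eqxx.
Qed.

Lemma contR_closed_ge0 A (r : T -> R) : closed A ->
  (forall x, A x -> cvgR (within A (nbhs x)) r (r x)) ->
  closed (A `&` [set x | 0 <= r x]).
Proof.
move=> cA hf x hx; have Ax : A x by apply: cA; apply: closureS hx => y [].
split=> //=; rewrite leNgt; apply/negP => rx.
have H : \forall y \near within A (nbhs x), 0 < - r y.
  by apply: (cvgR_gt0 _ (cvgR_opp _ (hf x Ax))); rewrite oppr_gt0.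
by have [y [[Ay fy] /(_ Ay)]] := hx _ H; rewrite oppr_gt0 ltNge fy.
Qed.

End Within.

Lemma contC_comp (T U : topologicalType) (A : set T) (B : set U) (h : U -> R[i])
    (k : T -> U) :
  {within A, continuous k} -> (forall x, A x -> B (k x)) -> contC B h ->
  contC A (fun x => h (k x)).
Proof.
move=> /subspace_continuousP ck kB ch x Ax.
move=> S hS.
have h1 : nbhs (k x) [set y | B y -> S (h y)] := ch _ (kB _ Ax) S hS.
have : nbhs x [set y | A y -> [set y | B y -> S (h y)] (k y)] := ck x Ax _ h1.
by apply: filterS => y hy Ay; exact: (hy Ay (kB _ Ay)).
Qed.


Lemma cvgC_fst (w : Cplx R * Cplx R) : cvgC (nbhs w) fst w.1.
Proof. exact: cvg_fst. Qed.

Lemma cvgC_snd (w : Cplx R * Cplx R) : cvgC (nbhs w) snd w.2.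
Proof. exact: cvg_snd. Qed.

Lemma cvgC_within (T : topologicalType) (A : set T) (x : T) f a :
  cvgC (nbhs x) f a -> cvgC (within A (nbhs x)) f a.
Proof.
move=> h S hS; have : nbhs x [set y | S (f y)] := h S hS.
by apply: filterS => y hy _.
Qed.

Lemma contC_fst (A : set (Cplx R * Cplx R)) : contC A fst.
Proof. by move=> x Ax; apply: cvgC_within; exact: cvgC_fst. Qed.

Lemma contC_snd (A : set (Cplx R * Cplx R)) : contC A snd.
Proof. by move=> x Ax; apply: cvgC_within; exact: cvgC_snd. Qed.

Lemma contC_id (A : set (Cplx R)) : contC A id.
Proof. by move=> x Ax; apply: cvgC_within; exact: cvg_id. Qed.

End Limits.

(** * General topology *)

(** The inverse is continuous at f x because, by compactness and Hausdorff separation, the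
    values near f x are taken only near x. *)
Lemma compact_embedding (T U : topologicalType) (A : set T) (f : T -> U) :
  (exists x : T, True) -> hausdorff_space U -> compact A ->
  {within A, continuous f} -> {in A &, injective f} -> embedding_on A f.
Proof.
move=> [x0 _] hU cA cf injf.
pose g y := xget x0 [set x | A x /\ f x = y].
have gK x : A x -> g (f x) = x.
  move=> Ax; rewrite /g; case: xgetP => [x' -> [Ax' e]|/(_ x)[]//].
  by apply: injf; rewrite ?inE.
exists g; split.
- by move=> x Ax; exists x.
- by move=> _ [x Ax <-]; rewrite gK.
- by move=> x /set_mem; exact: gK.
- by move=> _ /set_mem[x Ax <-]; rewrite gK.
split=> //; apply/subspace_continuousP => _ [x Ax <-].
rewrite /from_subspace gK // => N nN.
(* A point z of A other than x has a neighbourhood on which f stays away from f x. *)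
have hcov : near_covering A by exact/compact_near_coveringP.
have H : \forall y \near nbhs (f x), A `<=` [set z | A z -> f z = y -> N z].
  apply: hcov => z Az /=.
  have [e|ne] := eqVneq (f z) (f x).
    have -> : z = x by apply: injf; rewrite ?inE.
    exists (N, setT) => /=; first by split => //; exact: filterT.
    by move=> [u v] /= [Nu _] _ _.
  move: (hU); rewrite open_hausdorff => /(_ _ _ ne) [[V1 V2]] /= [/set_mem V1z /set_mem V2x] [oV1 oV2 V12].
  have h1 : nbhs z [set u | A u -> V1 (f u)].
    by move/subspace_continuousP: cf => /(_ z Az V1); apply; exact: open_nbhs_nbhs.
  exists ([set u | A u -> V1 (f u)], V2) => /=; first by split => //; exact: open_nbhs_nbhs.
  move=> [u v] /= [hu hv] Au fuv; exfalso.
  by have : (V1 `&` V2) (f u); [split; [exact: hu|rewrite fuv]|rewrite (eqP V12)].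
rewrite /within /=; apply: filterS H => y hy [z Az fz] /=.
by rewrite -fz gK //; apply: hy.
Qed.

(** Pasting along a finite closed cover: near a point, only the members of the cover
    which contain this point matter. *)
Lemma closed_cover_continuous (I : finType) (T U : topologicalType) (A : set T)
    (C : I -> set T) (f : T -> U) (h : I -> T -> U) :
  (forall i, closed (C i)) ->
  (forall x, A x -> exists i, C i x) ->
  (forall i x, A x -> C i x -> h i @ within A (nbhs x) --> h i x) ->
  (forall i x, A x -> C i x -> f x = h i x) ->
  {within A, continuous f}.
Proof.
move=> clC cov hc fh; apply/subspace_continuousP => x Ax; rewrite /from_subspace => S hS.
have H : nbhs x [set y | forall i, C i y -> A y -> S (h i y)].
  apply: filter_forall => i; have [Cx|nCx] := pselect (C i x).
    have hS' : nbhs (h i x) S by rewrite -(fh i x).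
    have : nbhs x [set y | A y -> S (h i y)] := hc i x Ax Cx S hS'.
    by apply: filterS => y hy _.
  have : nbhs x (~` C i).
    by apply: open_nbhs_nbhs; split => //; rewrite openC; exact: clC.
  by apply: filterS => y ny Cy; case: ny.
rewrite /= /within /=; apply: filterS H => y hy Ay.
by have [i Ci] := cov y Ay; rewrite /= (fh i y) //; apply: hy.
Qed.

(** * Compactness and continuity of the uniformisation *)

Section PhiContinuous.
Variable R : realType.

Definition contP (T : topologicalType) (A : set T) (P : T -> hpt R) :=
  [/\ contC A (fun w => hx (P w)), contC A (fun w => hy (P w)),
      contC A (fun w => hz (P w)) & contC A (fun w => heta (P w))].

Definition contT (T : topologicalType) (A : set T) (t : T -> R[i] * R[i]) :=
  contC A (fun w => (t w).1) /\ contC A (fun w => (t w).2).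

Section Fixed.
Variables (T : topologicalType) (A : set T).
Implicit Types (P : T -> hpt R) (f : T -> R[i]).

Lemma contC_mul f (g : T -> R[i]) : contC A f -> contC A g -> contC A (fun w => f w * g w).
Proof. by move=> hf hg x Ax; apply: cvgC_mul; [exact: hf|exact: hg]. Qed.
Lemma contC_add f (g : T -> R[i]) : contC A f -> contC A g -> contC A (fun w => f w + g w).
Proof. by move=> hf hg x Ax; apply: cvgC_add; [exact: hf|exact: hg]. Qed.
Lemma contC_sub_fun f (g : T -> R[i]) : contC A f -> contC A g -> contC A (fun w => f w - g w).
Proof. by move=> hf hg x Ax; apply: cvgC_sub; [exact: hf|exact: hg]. Qed.
Lemma contC_cst (a : R[i]) : contC A (fun _ => a).
Proof. by move=> x Ax; apply: cvgC_cst. Qed.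
Lemma contC_exp f n : contC A f -> contC A (fun w => f w ^+ n).
Proof. by move=> hf x Ax; apply: cvgC_exp; exact: hf. Qed.
Lemma contC_conj f : contC A f -> contC A (fun w => (f w)^*).
Proof. by move=> hf x Ax; apply: cvgC_conj; exact: hf. Qed.

Lemma contR_cmod f w : contC A f -> A w ->
  cvgR (within A (nbhs w)) (fun x => cmod (f x)) (cmod (f w)).
Proof. by move=> h Aw; apply: cvgC_cmod; exact: h. Qed.

Lemma contP_rot P : contP A P -> contP A (fun w => rotE (P w)).
Proof.
case=> h1 h2 h3 h4; split; [exact: h1|exact: h2|exact: h3|].
exact (contC_mul (contC_cst (a := omega R)) h4).
Qed.

Lemma contP_flip P : contP A P -> contP A (fun w => flipE (P w)).
Proof.
case=> h1 h2 h3 h4.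
by split; [exact (contC_conj h1)|exact (contC_conj h2)|exact (contC_conj h3)
  |exact (contC_conj h4)].
Qed.

Lemma contP_act (g : bool * nat) P : contP A P -> contP A (fun w => actE g (P w)).
Proof.
case: g => b n h.
have h1 : contP A (fun w => if b then flipE (P w) else P w).
  by case: b; [exact: (contP_flip h)|exact: h].
rewrite /actE /dih /=; elim: n => [|n IH]; first exact: h1.
exact: (contP_rot IH).
Qed.

Lemma contC_resU P : contP A P -> contC A (fun w => hU (P w)).
Proof.
case=> h1 h2 h3 _; exact (contC_add (contC_add h1 (contC_mul (contC_cst (a := omega R ^+ 2)) h2))
  (contC_mul (contC_cst (a := omega R)) h3)).
Qed.

Lemma contC_resV P : contP A P -> contC A (fun w => hV (P w)).
Proof.
case=> h1 h2 h3 _; exact (contC_add (contC_add h1 (contC_mul (contC_cst (a := omega R)) h2))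
  (contC_mul (contC_cst (a := omega R ^+ 2)) h3)).
Qed.

Lemma closed_fund P : closed A -> contP A P -> closed (A `&` [set w | fund (P w)]).
Proof.
move=> cA hP; have hU_ := contC_resU hP; have hV_ := contC_resV hP.
case: (hP) => _ _ _ ht.
have hw : contC A (fun w => heta (P w) * (hV (P w))^*).
  exact (contC_mul ht (contC_conj hV_)).
have cl1 : closed (A `&` [set w | 0 <= nsq (hV (P w)) - nsq (hU (P w))]).
  apply: contR_closed_ge0 => // x Ax.
  by apply: cvgR_sub; apply: cvgC_nsq; [exact: hV_|exact: hU_].
have cl2 : closed (A `&` [set w | 0 <= Re (heta (P w) * (hV (P w))^*)]).
  by apply: contR_closed_ge0 => // x Ax; apply: cvgC_Re; exact: hw.
have cl3 : closed (A `&` [set w | 0 <= 3 * (Re (heta (P w) * (hV (P w))^*) *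
    Re (heta (P w) * (hV (P w))^*)) - Im (heta (P w) * (hV (P w))^*) *
    Im (heta (P w) * (hV (P w))^*)]).
  apply: contR_closed_ge0 => // x Ax; apply: cvgR_sub.
    by apply: cvgR_mul; [exact: cvgR_cst|apply: cvgR_mul; apply: cvgC_Re; exact: hw].
  by apply: cvgR_mul; apply: cvgC_Im; exact: hw.
have -> : A `&` [set w | fund (P w)] = (A `&` [set w | 0 <= nsq (hV (P w)) - nsq (hU (P w))])
   `&` ((A `&` [set w | 0 <= Re (heta (P w) * (hV (P w))^*)]) `&`
   (A `&` [set w | 0 <= 3 * (Re (heta (P w) * (hV (P w))^*) *
    Re (heta (P w) * (hV (P w))^*)) - Im (heta (P w) * (hV (P w))^*) *
    Im (heta (P w) * (hV (P w))^*)])).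
  apply/seteqP; split=> w /=; rewrite /fund /upper /sector !subr_ge0 -!expr2.
    by move=> [Aw /and3P[]].
  by move=> [[Aw h1] [[_ h2] [_ h3]]]; split=> //; apply/and3P.
by apply: closedI => //; apply: closedI.
Qed.

Lemma contT_alcove P : contP A P -> (forall w, A w -> curve (P w)) ->
  contT A (fun w => alcove (bary (P w))).
Proof.
case=> h1 h2 h3 _ hc.
have hb w : A w -> [/\ cvgR (within A (nbhs w)) (fun w => (bary (P w)).1.1) (bary (P w)).1.1,
   cvgR (within A (nbhs w)) (fun w => (bary (P w)).1.2) (bary (P w)).1.2 &
   cvgR (within A (nbhs w)) (fun w => (bary (P w)).2) (bary (P w)).2].
  move=> Aw; have L := lt0r_neq0 (perim_gt0 (hc w Aw)).
  have k1 := contR_cmod h1 Aw; have k2 := contR_cmod h2 Aw.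
  have k3 := contR_cmod h3 Aw.
  have kL : cvgR (within A (nbhs w)) (fun w => perim (P w)) (perim (P w)).
    by apply: cvgR_add; first apply: cvgR_add.
  by split; apply: cvgR_mul; try (exact: cvgR_inv); apply: cvgR_sub => //; apply: cvgR_add.
split=> w Aw; have [b1 b2 b3] := hb w Aw; apply: cvgC_e; apply: cvgR_mul; try exact: cvgR_cst.
  by apply: cvgR_add => //; apply: cvgR_mul => //; exact: cvgR_cst.
exact: cvgR_sub.
Qed.

Lemma contT_act (g : bool * nat) t : contT A t -> contT A (fun w => actT g (t w)).
Proof.
have hr s : contT A s -> contT A (fun w => rotT (s w)).
  by case=> h1 h2; split; [exact: h2|exact (contC_conj (contC_mul h1 h2))].
have hf s : contT A s -> contT A (fun w => flipT (s w)).
  by case=> h1 h2; split; [exact: h1|exact (contC_conj (contC_mul h1 h2))].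
case: g => b n ht; rewrite /actT /dih /=; elim: n => [|n IH] /=; last exact: (hr _ IH).
by case: b; [exact: (hf _ ht)|exact: ht].
Qed.

Lemma actE_mod b n (P : hpt R) : actE (b, n) P = actE (b, (n %% 3)%N) P.
Proof. exact: iter_rotE. Qed.

(** The sets on which a given element of the group brings P into the fundamental domain
    are closed, and cover; on each of them Phi has an explicit continuous formula. *)
Lemma Phi_continuous P : closed A -> contP A P -> (forall w, A w -> curve (P w)) ->
  {within A, continuous (fun w => Phi (P w) : Cplx R * Cplx R)}.
Proof.
move=> cA hP hc.
(* Rotations are counted modulo 3 to make the cover finite. *)
pose nat_of (g : bool * 'I_3) : bool * nat := (g.1, nat_of_ord g.2).
apply: (@closed_cover_continuous (bool * 'I_3)%type T (Cplx R * Cplx R)%type A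
  (fun g => A `&` [set w | fund (actE (nat_of g) (P w))]) (fun w => Phi (P w))
  (fun g w => actT (dih_inv (nat_of g)) (alcove (bary (P w)))) _ _ _ _).
- by move=> g; apply: closed_fund; [exact: cA|exact: (contP_act (nat_of g) hP)].
- move=> w Aw; have [[b n] hg] := fund_cover (P w).
  exists (b, inord (n %% 3)); split => //=; rewrite /nat_of /= inordK ?ltn_mod //.
  by rewrite -actE_mod.
- move=> g w Aw _; have [k1 k2] := contT_act (dih_inv (nat_of g)) (contT_alcove hP hc).
  move/subspace_continuousP: (contC_within2 k1 k2) => /(_ w Aw).
  rewrite /from_subspace -!surjective_pairing.
  rewrite (_ : (fun x => _) = (fun w => actT (dih_inv (nat_of g)) (alcove (bary (P w))))) //.
  by apply/funext => x; rewrite -surjective_pairing.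
- move=> g w Aw [_ hg]; apply: Phi_eq; first exact: hc.
  split; first by apply: actT_torus; exact: alcove_torus.
  by exists (nat_of g) => //; rewrite actT_invK //; exact: alcove_torus.
Qed.

End Fixed.

Lemma discE (z : R[i]) : disc (z : Cplx R) <-> nsq z <= 1.
Proof. by rewrite /disc /= normC_le1. Qed.

Lemma circleE (z : R[i]) : circle (z : Cplx R) <-> nsq z = 1.
Proof. exact: normC_eq1. Qed.

Lemma torusE (t : R[i] * R[i]) : torus (t : Cplx R * Cplx R) <-> on_torus t.
Proof. by split=> -[/circleE h1 /circleE h2]. Qed.

Lemma contR_nsq (T : topologicalType) (A : set T) (f : T -> R[i]) : contC A f ->
  forall x, A x -> cvgR (within A (nbhs x)) (fun x => nsq (f x)) (nsq (f x)).
Proof. by move=> h x Ax; apply: cvgC_nsq; exact: h. Qed.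

Lemma closed_nsq_le (r : R) : closed ([set z | nsq z <= r] : set (Cplx R)).
Proof.
rewrite (_ : [set z | nsq z <= r] = setT `&` [set z | 0 <= r - nsq z] :> set (Cplx R)).
  apply: contR_closed_ge0; first exact: closedT.
  by move=> x _; apply: cvgR_sub; [exact: cvgR_cst|apply: contR_nsq => //; exact: contC_id].
by apply/seteqP; split=> z /=; rewrite subr_ge0 // => -[].
Qed.

Lemma compact_nsq_le (r : R) : compact ([set z | nsq z <= r] : set (Cplx R)).
Proof.
pose s := 1 + `|r|.
have cI : compact (`[- s, s]%classic : set R) by exact: segment_compact.
have cS := compact_setX cI cI.
pose f (w : R * R) : Cplx R := w.1 +i* w.2.
have cf : {within `[- s, s]%classic `*` `[- s, s]%classic, continuous f}.
  apply/subspace_continuousP => w _; apply: (@cvgC_within R _ _ _ f (f w)).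
  by apply: cvgC_ReIm; [exact: cvg_fst|exact: cvg_snd].
apply: (subclosed_compact (@closed_nsq_le r) (continuous_compact cf cS)).
move=> [a b]; rewrite /nsq /= => h; exists (a, b) => //; split=> /=; rewrite in_itv /= -ler_norml.
  have : `|a| ^+ 2 <= s ^+ 2.
    rewrite real_normK ?num_real //; have := sqr_ge0 b; have := ler_norm r; rewrite /s.
    have := normr_ge0 r; nra.
  by rewrite ler_pXn2r // nnegrE // addr_ge0.
have : `|b| ^+ 2 <= s ^+ 2.
  rewrite real_normK ?num_real //; have := sqr_ge0 a; have := ler_norm r; rewrite /s.
  have := normr_ge0 r; nra.
by rewrite ler_pXn2r // nnegrE // addr_ge0.
Qed.

Lemma disc_nsq : @disc R = [set z : Cplx R | nsq (z : R[i]) <= 1].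
Proof. by apply/seteqP; split=> z /discE. Qed.

Lemma compact_disc : compact (@disc R).
Proof. by rewrite disc_nsq; exact: compact_nsq_le. Qed.

Lemma closed_disc : closed (@disc R).
Proof. by rewrite disc_nsq; exact: closed_nsq_le. Qed.

Lemma hausdorff_C2 : @hausdorff_space (Cplx R * Cplx R)%type.
Proof. exact: norm_hausdorff. Qed.

End PhiContinuous.

(** * Capping off the covering *)

Section Capping.
Variable R : realType.
Variables p1 p2 p3 : R[i].
Hypotheses (d1 : nsq p1 < 1) (d2 : nsq p2 < 1) (d3 : nsq p3 < 1).
Hypotheses (n12 : p1 != p2) (n13 : p1 != p3) (n23 : p2 != p3).

Local Notation omega := (omega R).

Definition Q (z : R[i]) := (z - p1) * (z - p2) * (z - p3).

Definition X : set (Cplx R * Cplx R) := cyclic_cover3 [:: p1; p2; p3].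

Lemma coverE w : X w <-> nsq w.1 <= 1 /\ (w.2 : R[i]) ^+ 3 = Q w.1.
Proof.
case: w => z y; rewrite /X /cyclic_cover3 /= !big_cons big_nil /disc /= normC_le1.
rewrite (_ : (z - p1) * _ = Q z) //.
by rewrite /Q mulr1 !mulrA.
Qed.

(** The coefficients of the linear relation between the forms z - p i. *)
Let c1 := p2 - p3.
Let c2 := p3 - p1.
Let c3 := p1 - p2.

Lemma c_neq0 : [/\ c1 != 0, c2 != 0 & c3 != 0].
Proof. by rewrite !subr_eq0 [p3 == p1]eq_sym; split. Qed.

(** The constant which turns y^3 = Q z into eta^3 = x y z. *)
Definition kap := xget 0 [set k : R[i] | k ^+ 3 = c1 * c2 * c3].

Lemma kapE : kap ^+ 3 = c1 * c2 * c3.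
Proof.
rewrite /kap; case: xgetP => [k -> //|h].
by have [k hk] := cube_root_exists (c1 * c2 * c3); case: (h k).
Qed.

Lemma kap_neq0 : kap != 0.
Proof.
have [h1 h2 h3] := c_neq0.
have : kap ^+ 3 != 0 by rewrite kapE !mulf_neq0.
by rewrite expf_eq0.
Qed.

(** The point of the homogeneous curve over [u : v]: the covering is the part v = 1,
    |u| <= 1, and its complement is the part u = 1, |v| < 1. *)
Definition lift u v y := Hpt (c1 * (u - p1 * v)) (c2 * (u - p2 * v))
  (c3 * (u - p3 * v)) (kap * y).

Definition lift_ok (u v y : R[i]) :=
  (u, v) <> (0, 0) /\ y ^+ 3 = (u - p1 * v) * (u - p2 * v) * (u - p3 * v).

Lemma lift_lin u v : u - p1 * v = 0 -> u - p2 * v = 0 -> (u, v) = (0, 0).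
Proof.
move=> h1 h2; have : (p1 - p2) * v = 0.
  by rewrite -[RHS](subrr (0 : R[i])) -{1}h2 -h1; ring.
move/eqP; rewrite mulf_eq0 subr_eq0 (negPf n12) /= => /eqP v0.
by move: h1; rewrite v0 mulr0 subr0 => ->.
Qed.

Lemma curve_lift u v y : lift_ok u v y -> curve (lift u v y).
Proof.
move=> [h1 h2]; have [k1 k2 k3] := c_neq0; split => /=.
- rewrite /c1 /c2 /c3; ring.
- by rewrite exprMn kapE h2; ring.
- move=> [] /eqP; rewrite mulf_eq0 (negPf k1) /= => /eqP e1 /eqP.
  by rewrite mulf_eq0 (negPf k2) /= => /eqP e2; apply: h1; exact: lift_lin.
Qed.

Lemma lift_scale l u v y : scale l (lift u v y) = lift (l * u) (l * v) (l * y).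
Proof. by rewrite /scale /lift /=; congr Hpt; ring. Qed.

Lemma lift_inj u v y u' v' y' : lift u v y = lift u' v' y' ->
  [/\ u = u', v = v' & y = y'].
Proof.
have [k1 k2 k3] := c_neq0.
case=> /(mulfI k1) e1 /(mulfI k2) e2 _ /(mulfI kap_neq0) ->.
have [h1 h2] : u - u' - p1 * (v - v') = 0 /\ u - u' - p2 * (v - v') = 0.
  split.
  - transitivity ((u - p1 * v) - (u' - p1 * v')); first by ring.
    by rewrite e1 subrr.
  - transitivity ((u - p2 * v) - (u' - p2 * v')); first by ring.
    by rewrite e2 subrr.
have [] := lift_lin h1 h2.
by move=> /eqP; rewrite subr_eq0 => /eqP -> /eqP; rewrite subr_eq0 => /eqP ->.
Qed.

Lemma lift_surj P : curve P -> exists u v y, lift_ok u v y /\ P = lift u v y.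
Proof.
move=> [h1 h2 h3]; have [k1 k2 k3] := c_neq0.
pose v := (hx P / c1 - hy P / c2) / (p2 - p1); pose u := hx P / c1 + p1 * v.
have n21 : p2 - p1 != 0 by rewrite subr_eq0 eq_sym.
have ex : hx P = c1 * (u - p1 * v) by rewrite /u addrK mulrCA mulfV // mulr1.
have ey : hy P = c2 * (u - p2 * v).
  rewrite (_ : u - p2 * v = hx P / c1 - (p2 - p1) * v); last by rewrite /u; ring.
  rewrite /v [(p2 - p1) * _]mulrCA mulfV // mulr1 opprB addrCA subrr addr0.
  by rewrite mulrCA mulfV // mulr1.
have ez : hz P = c3 * (u - p3 * v).
  have -> : hz P = - hx P - hy P by apply/eqP; rewrite -subr_eq0 -h1; apply/eqP; ring.
  rewrite ex ey /c1 /c2 /c3; ring.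
have et : heta P = kap * (heta P / kap) by rewrite mulrCA mulfV ?mulr1 ?kap_neq0.
exists u, v, (heta P / kap); split; last by rewrite /lift -ex -ey -ez -et; case: (P).
split; first by case=> hu hv; apply: h3; rewrite ex ey hu hv !mulr0 !subr0 !mulr0.
apply: (@mulfI _ (kap ^+ 3)); first by rewrite expf_neq0 ?kap_neq0.
rewrite -exprMn -et h2 ex ey ez kapE; ring.
Qed.

Lemma Phi_lift_inj u v y u' v' y' : lift_ok u v y -> lift_ok u' v' y' ->
  Phi (lift u v y) = Phi (lift u' v' y') ->
  exists2 l, l != 0 & [/\ u' = l * u, v' = l * v & y' = l * y].
Proof.
move=> h h' /(Phi_inj (curve_lift h) (curve_lift h'))[l l0].
by rewrite lift_scale => /lift_inj[e1 e2 e3]; exists l.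
Qed.

Lemma Phi_lift_scale l u v y : l != 0 -> lift_ok u v y ->
  Phi (lift (l * u) (l * v) (l * y)) = Phi (lift u v y).
Proof. by move=> l0 h; rewrite -lift_scale Phi_scale //; exact: curve_lift. Qed.

(** A continuous cube root of the product of the 1 - p i zeta on the closed disc, where
    each factor lies in the right half-plane. *)
Definition rho (z : R[i]) := crt (1 - p1 * z) * crt (1 - p2 * z) * crt (1 - p3 * z).

Lemma Re_factor_gt0 (p z : R[i]) : nsq p < 1 -> nsq z <= 1 -> 0 < Re (1 - p * z).
Proof.
move=> hp hz; have : nsq (p * z) < 1.
  rewrite nsqM; apply: le_lt_trans hp; rewrite -[leRHS]mulr1.
  by rewrite ler_wpM2l ?nsq_ge0.
rewrite /nsq ReD ReN Re1 => h; have := sqr_ge0 (Im (p * z)); nra.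
Qed.

Lemma rho_cube z : rho z ^+ 3 = (1 - p1 * z) * (1 - p2 * z) * (1 - p3 * z).
Proof. by rewrite !exprMn !crtK. Qed.

Lemma rho_neq0 z : nsq z <= 1 -> rho z != 0.
Proof.
move=> hz; have aux p : nsq p < 1 -> crt (1 - p * z) != 0.
  move=> hp; apply: crt_neq0; apply/eqP => h; have := Re_factor_gt0 hp hz.
  by rewrite h Re0 ltxx.
by rewrite !mulf_neq0 ?aux.
Qed.

Lemma cont_rho : contC (@disc R) rho.
Proof.
have aux p : nsq p < 1 -> contC (@disc R) (fun z : R[i] => crt (1 - p * z)).
  move=> hp x Dx; have /discE hx := Dx; apply: cvgC_crt.
  - by rewrite ltW // Re_factor_gt0.
  - by apply: filterS (withinT _ _) => // z /discE hz; rewrite ltW // Re_factor_gt0.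
  - apply: cvgC_sub; first exact: cvgC_cst.
    apply: cvgC_mul; first exact: cvgC_cst.
    exact: contC_id Dx.
exact (contC_mul (contC_mul (aux p1 d1) (aux p2 d2)) (aux p3 d3)).
Qed.

Definition emb (w : Cplx R * Cplx R) : Cplx R * Cplx R := Phi (lift w.1 1 w.2).

(** The three sheets of the curve over the complement of the disc, in the coordinate
    zeta = 1 / z. *)
Definition cap (j : 'I_3) (z : Cplx R) : Cplx R * Cplx R :=
  Phi (lift 1 z (omega ^+ j * rho z)).

Lemma omegaX3 j : (omega ^+ j) ^+ 3 = 1.
Proof. by rewrite exprAC omega3 expr1n. Qed.

Lemma emb_ok w : X w -> lift_ok w.1 1 w.2.
Proof.
move=> /coverE[_ h]; split; last by rewrite h !mulr1.
by move=> -[_ /eqP]; rewrite oner_eq0.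
Qed.

Lemma cap_ok j z : lift_ok 1 z (omega ^+ j * rho z).
Proof.
split; last by rewrite exprMn omegaX3 mul1r rho_cube.
by move=> -[/eqP]; rewrite oner_eq0.
Qed.

Lemma cont_Q (A : set (Cplx R * Cplx R)) : contC A (fun w => Q w.1).
Proof.
have aux p : contC A (fun w => (w.1 : R[i]) - p).
  exact (contC_sub_fun (contC_fst (A := A)) (contC_cst (a := p))).
exact (contC_mul (contC_mul (aux p1) (aux p2)) (aux p3)).
Qed.

Lemma factor_bound (p z : R[i]) : nsq p < 1 -> nsq z <= 1 -> nsq (z - p) <= 4.
Proof.
move=> hp hz; rewrite -cmodX2.
have h1 (w : R[i]) : nsq w <= 1 -> cmod w <= 1.
  by move=> h; rewrite -(@ler_pXn2r _ 2) ?nnegrE ?cmod_ge0 // cmodX2 expr1n.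
have := h1 z hz; have := h1 p (ltW hp); have := cmodD z (- p); rewrite cmodN.
have := cmod_ge0 (z - p); nra.
Qed.

Lemma X_bound w : X w -> nsq w.2 <= 4.
Proof.
move=> /coverE[hz hy]; rewrite -(@ler_pXn2r _ 3) ?nnegrE ?nsq_ge0 //.
rewrite -nsqX hy /Q !nsqM (_ : 4 ^+ 3 = 4 * 4 * 4 :> R); last by ring.
apply: ler_pM; rewrite ?mulr_ge0 ?nsq_ge0 ?factor_bound //.
by apply: ler_pM; rewrite ?nsq_ge0 ?factor_bound.
Qed.

Lemma closed_X : closed X.
Proof.
rewrite (_ : X = (fst @^-1` @disc R) `&` [set w | (w.2 : R[i]) ^+ 3 - Q w.1 = 0]).
  apply: contC_closed0.
    apply: (proj1 (@continuous_closedP _ _ (@fst (Cplx R) (Cplx R)))) (@closed_disc R).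
    by move=> w; exact: cvg_fst.
  exact (contC_sub_fun (contC_exp (n := 3) (contC_snd (A := _))) (@cont_Q _)).
apply/seteqP; split=> w.
  by move=> /coverE[/discE h1 h2]; split; rewrite /= ?h2 ?subrr.
by move=> [/discE h1 /eqP]; rewrite subr_eq0 => /eqP h2; apply/coverE.
Qed.

Lemma compact_X : compact X.
Proof.
apply: (subclosed_compact closed_X (compact_setX (@compact_disc R) (@compact_nsq_le R 4))).
by move=> w hw; split; [have /coverE[/discE] := hw|exact: X_bound].
Qed.

Lemma hausdorff_X : hausdorff_space (subspace X).
Proof. exact: subspace_hausdorff (@hausdorff_C2 R). Qed.

Lemma emb_embedding : embedding_on X emb.
Proof.
apply: compact_embedding; [by exists point|exact: hausdorff_C2|..].
- exact: compact_X.
- refine (@Phi_continuous R _ X (fun w => lift w.1 1 w.2) closed_X _ _).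
    have aux c p : contC X (fun w => c * ((w.1 : R[i]) - p * 1)).
      exact (contC_mul (contC_cst (a := c))
        (contC_sub_fun (contC_fst (A := X)) (contC_cst (a := p * 1)))).
    split; [exact (aux c1 p1)|exact (aux c2 p2)|exact (aux c3 p3)|].
    exact (contC_mul (contC_cst (a := kap)) (contC_snd (A := X))).
  by move=> w /emb_ok; exact: curve_lift.
- move=> [z y] [z' y'] /set_mem/emb_ok h /set_mem/emb_ok h'.
  move=> /(Phi_lift_inj h h')[l l0 [/= -> e2 ->]].
  by rewrite -[l]mulr1 -e2 !mul1r.
Qed.

Lemma cap_embedding j : embedding_on (@disc R) (cap j).
Proof.
apply: compact_embedding; [by exists point|exact: hausdorff_C2|..].
- exact: compact_disc.
- refine (@Phi_continuous R _ (@disc R) (fun z => lift 1 z (omega ^+ j * rho z)) (@closed_disc R) _ _).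
    have aux c p : contC (@disc R) (fun z : Cplx R => c * (1 - p * (z : R[i]))).
      exact (contC_mul (contC_cst (a := c))
        (contC_sub_fun (contC_cst (a := 1))
          (contC_mul (contC_cst (a := p)) (contC_id (A := @disc R))))).
    split; [exact (aux c1 p1)|exact (aux c2 p2)|exact (aux c3 p3)|].
    exact (contC_mul (contC_cst (a := kap)) (contC_mul (contC_cst (a := omega ^+ j)) cont_rho)).
  by move=> z _; apply: curve_lift; exact: cap_ok.
- move=> z z' _ _ /(Phi_lift_inj (cap_ok j z) (cap_ok j z'))[l l0 [e1 e2 _]].
  by rewrite e2 -[l]mulr1 -e1 mul1r.
Qed.

(** A component of the part of the covering over the unit circle, where
    z - p = z (1 - p z^* ). *)
Definition rim (j : 'I_3) : set (Cplx R * Cplx R) :=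
  [set w | nsq (w.1 : R[i]) = 1 /\ (w.2 : R[i]) = omega ^+ j * (w.1 * rho (w.1 : R[i])^*)].

Lemma unit_inv (z : R[i]) : nsq z = 1 -> z * z^* = 1.
Proof. by move=> h; rewrite -nsqE h. Qed.

Lemma rim_cube (z : R[i]) : nsq z = 1 -> (z * rho z^*) ^+ 3 = Q z.
Proof.
move=> h; rewrite exprMn rho_cube /Q; have hz := unit_inv h.
transitivity ((z - p1 * (z * z^*)) * (z - p2 * (z * z^*)) * (z - p3 * (z * z^*))).
  by ring.
by rewrite hz !mulr1.
Qed.

Lemma rim_X j : rim j `<=` X.
Proof.
move=> w [h1 h2]; apply/coverE; split; first by rewrite h1.
by rewrite h2 exprMn omegaX3 mul1r rim_cube.
Qed.

Lemma rim_cover w : X w -> nsq (w.1 : R[i]) = 1 -> exists j, rim j w.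
Proof.
move=> /coverE[_ h] h1; rewrite -(rim_cube h1) in h.
by have [j hj] := cube_eq h; exists j.
Qed.

Lemma omegaX_inj (i j : 'I_3) : omega ^+ i = omega ^+ j -> i = j.
Proof.
move=> h; apply: val_inj => /=; have o1 := omega_neq1 R; have o0 := omega_neq0 R.
have o2 : omega ^+ 2 != 1.
  apply: contra_neq o1 => h2; by rewrite -(omega3 R) exprSr h2 mul1r.
case: i j h => [[|[|[|//]]] ?] [[|[|[|//]]] ?] //= /eqP; rewrite ?expr0 ?expr1.
- by rewrite eq_sym (negPf o1).
- by rewrite eq_sym (negPf o2).
- by rewrite (negPf o1).
- by rewrite expr2 -{1}[omega]mulr1 (inj_eq (mulfI o0)) eq_sym (negPf o1).
- by rewrite (negPf o2).
- by rewrite expr2 -{3}[omega]mulr1 (inj_eq (mulfI o0)) (negPf o1).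
Qed.

Lemma cap_rim (z : R[i]) j : nsq z = 1 ->
  cap j z^* = emb (z, omega ^+ j * (z * rho z^*)).
Proof.
move=> h; have z0 : z != 0 by rewrite -nsq_gt0 h.
rewrite /cap /emb /= -(@Phi_lift_scale z 1 _ _ z0 (cap_ok _ _)).
by rewrite mulr1 unit_inv // mulrCA.
Qed.

Lemma cap_boundary j : cap j @` (@circle R) = emb @` rim j.
Proof.
apply/seteqP; split=> t [w].
- move=> /circleE hw <-; exists ((w : R[i])^*, omega ^+ j * ((w : R[i])^* * rho w)).
    by split; rewrite /= ?nsqJ ?conjcK.
  have := @cap_rim (w : R[i])^* j; rewrite conjcK nsqJ => -> //.
- case: w => z y [/= h1 h2] <-; exists (z : R[i])^*; first by apply/circleE; rewrite nsqJ.
  by rewrite cap_rim // -h2.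
Qed.

Lemma rim_homeo j : homeomorphic (rim j) (@circle R).
Proof.
exists (fun w => w.1), (fun z : Cplx R => (z, omega ^+ j * ((z : R[i]) * rho (z : R[i])^*))).
split.
- by move=> w [h _]; apply/circleE.
- by move=> z /circleE h.
- by move=> [z y] /set_mem[/= _ ->].
- by move=> z _.
split; first exact (contC_within (contC_fst (A := rim j))).
have cI := contC_id (A := @circle R).
apply: (contC_within2 cI).
apply: (contC_mul (contC_cst (a := omega ^+ j)) (contC_mul cI _)).
apply: (contC_comp (B := @disc R) (k := fun z : Cplx R => (z : R[i])^* : Cplx R) _ _ cont_rho).
  exact (contC_within (contC_conj cI)).
by move=> z /circleE h; apply/discE; rewrite nsqJ h.
Qed.

Lemma rim_disjoint i j : i != j -> rim i `&` rim j = set0.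
Proof.
move=> ij; apply/seteqP; split=> // w [[h1 h2] [_ h3]].
move/eqP: ij; apply; apply: omegaX_inj.
have h0 : (w.1 : R[i]) * rho (w.1 : R[i])^* != 0.
  by rewrite mulf_neq0 ?rho_neq0 ?nsqJ ?h1 // -nsq_gt0 h1.
by apply: (mulIf h0); rewrite -h2 -h3.
Qed.

Lemma cap_emb_meet j : emb @` X `&` cap j @` (@disc R) = cap j @` (@circle R).
Proof.
apply/seteqP; split=> t; last first.
  move=> ht; split; first by rewrite cap_boundary in ht; case: ht => w /rim_X hw <-; exists w.
  by case: ht => z /circleE h <-; exists z => //; apply/discE; rewrite h.
move=> [[w hw ew] [z /discE hz ez]]; exists z => //; apply/circleE.
have [l l0 [e1 e2 _]] := Phi_lift_inj (emb_ok hw) (cap_ok j z) (etrans ew (esym ez)).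
rewrite mulr1 in e2; move: e1; rewrite -e2 => e1.
have := congr1 (@nsq R) e1; rewrite nsqM (_ : nsq 1 = 1); last first.
  by rewrite /nsq Re1 Im1 expr1n expr0n addr0.
have /coverE[h1 _] := hw; move=> h.
apply/le_anti; rewrite hz /= h -[leRHS]mulr1 ler_wpM2l ?nsq_ge0 //.
Qed.

Lemma cap_disjoint i j : i != j -> cap i @` (@disc R) `&` cap j @` (@disc R) = set0.
Proof.
move=> ij; apply/seteqP; split=> // t [[z /discE hz ez] [z' /discE hz' ez']].
have [l l0 [e1 e2 e3]] := Phi_lift_inj (cap_ok i z) (cap_ok j z') (etrans ez (esym ez')).
move: e2 e3; rewrite -[l]mulr1 -e1 !mul1r => -> e3.
move/eqP: ij; apply; apply: omegaX_inj.
by apply: (mulIf (rho_neq0 hz)).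
Qed.

(** A point over [u : v] is in the covering or in a cap according as |u| <= |v| or not. *)
Lemma cap_emb_cover : @torus R =
  emb @` X `|` \bigcup_(j in [set: 'I_3]) (cap j @` (@disc R)).
Proof.
apply/seteqP; split=> t.
  move=> /torusE/Phi_surj[P /lift_surj[u [v [y [[h1 h2] ->]]]] <-].
  have ok : lift_ok u v y by [].
  have [hle|hlt] := lerP (nsq u) (nsq v).
    have v0 : v != 0.
      apply/eqP => v0; apply: h1; rewrite v0; congr (_, _); apply: nsq_le0.
      by move: hle; rewrite v0 {2}/nsq Re0 Im0 expr0n addr0.
    left; exists (u / v, y / v).
      apply/coverE; split => /=.
        by rewrite -(@ler_pM2r _ (nsq v)) ?nsq_gt0 // mul1r -nsqM divfK.
      by rewrite exprMn h2 /Q; field.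
    by have := Phi_lift_scale (invr_neq0 v0) ok; rewrite mulVf // ![v^-1 * _]mulrC.
  have u0 : u != 0 by rewrite -nsq_gt0; apply: le_lt_trans hlt; exact: nsq_ge0.
  right.
  have [j hj] : exists j : 'I_3, y / u = omega ^+ j * rho (v / u).
    apply: cube_eq; rewrite rho_cube exprMn h2; field.
    done.
  exists j => //; exists (v / u).
    by apply/discE; rewrite -(@ler_pM2r _ (nsq u)) ?nsq_gt0 // mul1r -nsqM divfK // ltW.
  have := Phi_lift_scale (invr_neq0 u0) ok.
  by rewrite /cap -hj mulVf // ![u^-1 * _]mulrC.
case=> [[w /emb_ok hw <-]|[j _ [z _ <-]]]; apply/torusE; apply: Phi_torus; apply: curve_lift.
  exact: hw.
exact: cap_ok.
Qed.

Lemma X_capped_off : capped_off R X rim (@torus R).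
Proof.
exists emb, cap; split.
- by split; [exact: emb_embedding|exact: cap_embedding].
- exact: cap_boundary.
- exact: cap_emb_meet.
- exact: cap_disjoint.
- exact: cap_emb_cover.
Qed.

End Capping.

(** * Connectedness *)

Section Connected.
Variable R : realType.

(** After division by b, the values of the function stay in the closed upper or lower
    half-plane; a multiplication by -i or i brings them to the right half-plane. *)
Lemma affine_cube_root (a b : R[i]) : exists c : R -> R[i],
  (forall s, c s ^+ 3 = a + s%:C * b) /\ (forall s : R, cvgC (nbhs s) c (c s)).
Proof.
have [b0|b0] := eqVneq b 0.
  have [c hc] := cube_root_exists a; exists (fun=> c); split=> s.
    by rewrite hc b0 mulr0 addr0.
  exact: cvgC_cst.
have [k hk] := cube_root_exists b.
have main (i : R[i]) : i ^+ 3 * i = 1 -> (forall s : R, 0 <= Re (i * (a / b + s%:C))) ->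
  exists c : R -> R[i],
  (forall s, c s ^+ 3 = a + s%:C * b) /\ (forall s : R, cvgC (nbhs s) c (c s)).
  move=> hi hpos; exists (fun s => k * i * crt (i * (a / b + s%:C))); split=> s.
    rewrite !exprMn hk crtK.
    transitivity (b * (a / b + s%:C) * (i ^+ 3 * i)); first by ring.
    by rewrite hi mulr1; field.
  apply: cvgC_mul; first exact: cvgC_cst.
  apply: cvgC_crt => //; first by apply: filterE.
  apply: cvgC_mul; first exact: cvgC_cst.
  apply: cvgC_add; first exact: cvgC_cst.
  apply: cvgC_real; exact: cvg_id.
have [h|h] := lerP 0 (Im (a / b)).
  apply: (main (0 +i* (-1))); first by apply: eqC; rewrite !exprS expr0 !ReImE /=; ring.
  by move=> s; move: (a / b) h => w h; rewrite !ReImE /=; lra.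
apply: (main (0 +i* 1)); first by apply: eqC; rewrite !exprS expr0 !ReImE /=; ring.
by move=> s; move: (a / b) h => w h; rewrite !ReImE /=; lra.
Qed.

Variables p1 p2 p3 : R[i].
Hypotheses (d1 : nsq p1 < 1).

Local Notation X := (X p1 p2 p3).

Lemma disc_segment (p z : R[i]) (s : R) : nsq p <= 1 -> nsq z <= 1 -> 0 <= s <= 1 ->
  nsq (p + s%:C * (z - p)) <= 1.
Proof.
move=> hp hz /andP[s0 s1].
have h1 (w : R[i]) : nsq w <= 1 -> cmod w <= 1.
  by move=> h; rewrite -(@ler_pXn2r _ 2) ?nnegrE ?cmod_ge0 // cmodX2 expr1n.
have := cmodD ((1 - s)%:C * p) (s%:C * z).
rewrite (_ : _ + _ = p + s%:C * (z - p)); last by rewrite rmorphB /=; ring.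
rewrite !cmodM !cmod_real ?subr_ge0 // => h.
rewrite -cmodX2 -(expr1n R 2) ler_pXn2r ?nnegrE ?cmod_ge0 //.
have s1' : 0 <= 1 - s by rewrite subr_ge0.
have := ler_wpM2l s0 (h1 z hz); have := ler_wpM2l s1' (h1 p hp); lra.
Qed.

(** The three factors of Q are affine along the segment from p1 to z, so that their cube
    roots can be followed along it; all the lifts start at the same point, as y = 0
    above p1. *)
Lemma path_to_branch w : X w -> exists f : R -> Cplx R * Cplx R,
  [/\ {within (`[0, 1]%classic : set R), continuous f}, f 0 = (p1, 0), f 1 = w &
      forall s, 0 <= s <= 1 -> X (f s)].
Proof.
case: w => z y /coverE[/= hz hy].
have [r1 [e1 k1]] := affine_cube_root 0 (z - p1).
have [r2 [e2 k2]] := affine_cube_root (p1 - p2) (z - p1).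
have [r3 [e3 k3]] := affine_cube_root (p1 - p3) (z - p1).
pose r s := r1 s * r2 s * r3 s.
have hr s : r s ^+ 3 = Q p1 p2 p3 (p1 + s%:C * (z - p1)).
  by rewrite !exprMn e1 e2 e3 /Q; ring.
have [j hj] : exists j : 'I_3, y = omega R ^+ j * r 1.
  by apply: cube_eq; rewrite hy hr (_ : p1 + _ = z) // mul1r addrC subrK.
exists (fun s => (p1 + s%:C * (z - p1), omega R ^+ j * r s)); split.
- apply: contC_within2 => s _; apply: cvgC_within.
    apply: cvgC_add; first exact: cvgC_cst.
    apply: cvgC_mul; last exact: cvgC_cst.
    apply: cvgC_real; exact: cvg_id.
  apply: cvgC_mul; first exact: cvgC_cst.
  by apply: cvgC_mul => //; exact: cvgC_mul.
- rewrite mul0r addr0; congr (_, _).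
  have : r1 0 ^+ 3 == 0 by rewrite e1 mul0r addr0.
  by rewrite expf_eq0 /= /r => /eqP ->; rewrite !mul0r mulr0.
- by rewrite hj mul1r addrC subrK.
- move=> s hs; apply/coverE; split; last by rewrite /= exprMn omegaX3 mul1r hr.
  by apply: disc_segment => //; exact: ltW.
Qed.

Lemma connected_X : connected X.
Proof.
pose lifts := [set f : R -> Cplx R * Cplx R |
  [/\ {within (`[0, 1]%classic : set R), continuous f}, f 0 = (p1, 0) &
      forall s, 0 <= s <= 1 -> X (f s)]].
have -> : X = \bigcup_(f in lifts) (f @` (`[0, 1]%classic : set R)).
  apply/seteqP; split=> w.
    move=> /path_to_branch[f [h1 h2 h3 h4]]; exists f => //; exists 1 => //.
    by rewrite /= in_itv /= ler01 lexx.
  by move=> [f [h1 h2 h3] [s]] /=; rewrite in_itv /= => /h3 + <-.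
apply: bigcup_connected.
  by exists (p1, 0) => f [_ <- _]; exists 0 => //; rewrite /= in_itv /= ler01 lexx.
move=> f [h1 _ _]; apply: connected_continuous_connected h1.
exact: segment_connected.
Qed.

End Connected.

(** * Charts with values in the complex plane *)

Section Charts.
Variable R : realType.

Definition toV (z : R[i]) : 'rV[R]_2 := \row_j (if j == 0 then Re z else Im z).
Definition toC (v : 'rV[R]_2) : R[i] := v 0 0 +i* v 0 1.

Lemma toVK z : toC (toV z) = z.
Proof. by rewrite /toC !mxE /=; case: z. Qed.

Lemma toCK v : toV (toC v) = v.
Proof.
apply/rowP => j; rewrite !mxE /toC.
by case: j => [[|[|//]] h] /=; congr (v 0 _); apply: val_inj.
Qed.

Lemma toVB z w : toV (z - w) = toV z - toV w.
Proof. by apply/rowP => j; rewrite !mxE ReD ImD ReN ImN; case: ifP. Qed.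

Lemma toV_norm z : `|toV z| <= cmod z.
Proof.
rewrite /Num.norm /= mx_normrE; apply: bigmax_le; first exact: cmod_ge0.
move=> [i j] _ /=; rewrite mxE; case: ifP => _; [exact: Re_le_cmod|exact: Im_le_cmod].
Qed.

(** The norm of 'rV_2 is the larger of the absolute values of the entries. *)
Lemma toC_norm v : cmod (toC v) <= 2 * `|v|.
Proof.
have h j : `|v 0 j| <= `|v|.
  rewrite {2}/Num.norm /= mx_normrE.
  exact: (@le_bigmax _ _ _ _ (fun i : 'I_1 * 'I_2 => `|v i.1 i.2|) (0, j)).
apply: le_trans (cmod_le_ReIm _) _; rewrite /=; have := h 0; have := h 1; lra.
Qed.

Lemma cvgC_toC (v : 'rV[R]_2) : cvgC (nbhs v) toC (toC v).
Proof. by apply: cvgC_ReIm; exact: coord_continuous. Qed.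

Lemma cvg_toV (T : Type) (F : set_system T) (FF : Filter F) (f : T -> R[i]) a :
  cvgC F f a -> (fun x => toV (f x)) @ F --> toV a.
Proof.
move=> /cvgCP h; apply/cvgrPdist_lt => eps e0.
by apply: filterS (h _ e0) => x; apply: le_lt_trans; rewrite -toVB; exact: toV_norm.
Qed.

(** The multiplication by d as a real matrix, acting on row vectors; its determinant is
    |d|^2. *)
Definition mulmat (d : R[i]) : 'M[R]_2 :=
  \matrix_(i, j) (if i == 0 then (if j == 0 then Re d else Im d)
                  else (if j == 0 then - Im d else Re d)).

Lemma toV_mul z d : toV z *m mulmat d = toV (d * z).
Proof.
apply/rowP => j; rewrite !mxE !big_ord_recl big_ord0 !mxE /= addr0 ReM ImM.
by case: (j == 0); ring.
Qed.

Lemma det_mulmat d : \det (mulmat d) = nsq d.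
Proof.
rewrite (expand_det_row _ 0) !big_ord_recl big_ord0 /cofactor !det_mx11 !mxE /= /nsq.
by rewrite expr0 expr1; ring.
Qed.

Variable T : topologicalType.
Implicit Types (D : set T) (I : set (Cplx R)) (phi : T -> R[i]) (psi : Cplx R -> T).

Definition cchart D I phi psi : chart R T :=
  Chart D [set v | I (toC v)] (fun x => toV (phi x)) (fun v => psi (toC v)).

Lemma cchart_of (A : set T) D I phi psi (O : set (Cplx R)) :
  rel_open A D -> open O -> (forall z, I z <-> 0 <= Im (z : R[i]) /\ O z) ->
  (forall x, D x -> I (phi x)) -> (forall z, I z -> D (psi z)) ->
  (forall x, D x -> psi (phi x) = x) -> (forall z, I z -> phi (psi z) = z) ->
  contC D phi -> {within I, continuous psi} ->
  chart_of A (cchart D I phi psi).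
Proof.
move=> hD hO hI hphi hpsi k1 k2 cphi /subspace_continuousP cpsi; split => //=.
  exists (toC @^-1` O).
    by apply: open_comp hO => v _; exact: cvgC_toC.
  by apply/seteqP; split=> v; [move=> /hI[]|move=> [h1 h2]; apply/hI].
split.
- by move=> x Dx /=; rewrite toVK; exact: hphi.
- by move=> v Iv; exact: hpsi.
- by move=> x /set_mem Dx /=; rewrite toVK k1.
- by move=> v /set_mem Iv /=; rewrite k2 // toCK.
split; apply/subspace_continuousP.
- by move=> x Dx; apply: cvg_toV; exact: cphi.
- move=> v Iv N hN.
  have h1 : nbhs (toC v : Cplx R) [set z | I z -> N (psi z)] := cpsi (toC v) Iv N hN.
  have : nbhs v [set u | [set z | I z -> N (psi z)] (toC u)] := cvgC_toC h1.
  by apply: filterS => u.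
Qed.

(** A complex derivative d <> 0 preserves the orientation, as the real determinant of
    the multiplication by d is |d|^2. *)
Lemma cchart_transition (A : set T) D I phi psi D' I' phi' psi' (x0 : T) (d : R[i]) :
  chart_of A (cchart D I phi psi) -> D x0 -> D' x0 -> d != 0 ->
  (forall eps : R, 0 < eps -> \forall x \near within (D `&` D') (nbhs x0),
     cmod (phi' x - phi' x0 - d * (phi x - phi x0)) <= eps * cmod (phi x - phi x0)) ->
  pos_jacobian_within (transition_dom (cchart D I phi psi) (cchart D' I' phi' psi'))
    (chart_map (cchart D' I' phi' psi') \o chart_inv (cchart D I phi psi))
    (toV (phi x0)).
Proof.
move=> [_ _ [/= hphi _ k1 _ [_ /subspace_continuousP cpsi]]] Dx0 Dx0' d0 h.
have {}k1 x : D x -> psi (phi x) = x by move=> /mem_set/k1; rewrite /= toVK.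
exists (mulmat d); first by rewrite det_mulmat nsq_gt0.
move=> eps e0; have e2 : 0 < eps / 2 by rewrite divr_gt0.
set near_le := [set x | (D `&` D') x ->
  cmod (phi' x - phi' x0 - d * (phi x - phi x0)) <= eps / 2 * cmod (phi x - phi x0)].
have h1 : nbhs (psi (toC (toV (phi x0)))) near_le by rewrite toVK k1 //; exact: h.
have h2 : nbhs (toV (phi x0)) [set v | I (toC v) -> near_le (psi (toC v))].
  exact: cpsi (toV (phi x0)) (hphi _ Dx0) _ h1.
rewrite /prop_near1 /within /=; move: h2; apply: filterS => v hv [x [Dx Dx'] /= exv].
have Ix : I (phi x) by have := hphi x Dx; rewrite /= toVK.
move: hv; rewrite -exv /= toVK k1 // => /(_ Ix (conj Dx Dx')) hx.
rewrite !toVK !k1 //.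
rewrite -!toVB toV_mul -toVB; apply: le_trans (toV_norm _) _.
apply: le_trans hx _; rewrite -[phi x - phi x0]toVK.
have := toC_norm (toV (phi x - phi x0)); rewrite !toVK.
nra.
Qed.

End Charts.

(** * The atlas *)

Section Atlas.
Variable R : realType.

(** At the points with y <> 0 the coordinate phi has a non-zero derivative with respect to
    z, in the form of Caratheodory: a slope S continuous at the point. *)
Definition zcoord (D : set (Cplx R * Cplx R)) (phi : Cplx R * Cplx R -> R[i]) :=
  forall x0, D x0 -> x0.2 != 0 -> exists S : Cplx R * Cplx R -> R[i],
    [/\ S x0 != 0, cvgC (within D (nbhs x0)) S (S x0) &
        forall x, D x -> (x.1 : R[i]) - x0.1 = S x * (phi x - phi x0)].

Lemma quotient_slope (T : Type) (F : set_system T) (FF : Filter F) (D : set T)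
    (S S' phi phi' : T -> R[i]) (s s' a a' : R[i]) :
  (\forall x \near F, D x) -> s' != 0 -> cvgC F S s -> cvgC F S' s' ->
  (forall x, D x -> S x * (phi x - a) = S' x * (phi' x - a')) ->
  forall eps : R, 0 < eps -> \forall x \near F,
    cmod (phi' x - a' - s / s' * (phi x - a)) <= eps * cmod (phi x - a).
Proof.
move=> hD s0 cS cS' h eps e0.
have kq : cvgC F (fun x => S x * (S' x)^-1) (s / s').
  by apply: cvgC_mul; [exact: cS|apply: (cvgC_inv _ s0); exact: cS'].
have n1 := cvgC_neq0 FF cS' s0.
move/cvgCP: kq => /(_ _ e0) n2.
apply: filterS3 n1 n2 hD => x hx hq Dx.
have e1 : phi' x - a' = S x / S' x * (phi x - a).
  by apply: (mulfI hx); rewrite -h // mulrA [S' x * _]mulrCA mulfV // mulr1.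
rewrite e1 -mulrBl cmodM ler_wpM2r ?cmod_ge0 // cmodB; exact: ltW.
Qed.

(** The slope of one coordinate with respect to another is the quotient of their slopes
    with respect to z. *)
Lemma zcoord_transition D D' phi phi' x0 : zcoord D phi -> zcoord D' phi' ->
  D x0 -> D' x0 -> x0.2 != 0 -> exists2 d : R[i], d != 0 &
  forall eps : R, 0 < eps -> \forall x \near within (D `&` D') (nbhs x0),
    cmod (phi' x - phi' x0 - d * (phi x - phi x0)) <= eps * cmod (phi x - phi x0).
Proof.
move=> hD hD' Dx Dx' y0; have [S [S0 cS eS]] := hD x0 Dx y0.
have [S' [S0' cS' eS']] := hD' x0 Dx' y0.
exists (S x0 / S' x0); first by rewrite mulf_neq0 // invr_neq0.
have sub (B : set (Cplx R * Cplx R)) (f : Cplx R * Cplx R -> R[i]) a : D `&` D' `<=` B ->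
    cvgC (within B (nbhs x0)) f a -> cvgC (within (D `&` D') (nbhs x0)) f a.
  move=> hB h N hN; have : nbhs x0 [set y | B y -> N (f y)] := h N hN.
  by apply: filterS => y hy /hB.
have kS := sub D S _ (@subIsetl _ _ _) cS.
have kS' := sub D' S' _ (@subIsetr _ _ _) cS'.
apply: (quotient_slope (D := D `&` D') _ _ S0' kS kS').
  exact: withinT.
by move=> x [Dxx Dxx']; rewrite -eS // -eS'.
Qed.

(** The interior of narrow. *)
Definition opensec (y : R[i]) := 0 < Re y /\ 0 < Re y * Re y - 3 * (Im y * Im y).

Lemma opensecP y : opensec y <-> narrow y /\ 0 < Re (y ^+ 3).
Proof.
rewrite /opensec /narrow Re_cube -!expr2; split.
  by move=> [h1 h2]; rewrite (ltW h1) mulr_gt0 //; split=> //; lra.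
move=> [/andP[h1 h2] h3]; have {}h1 : 0 < Re y.
  by rewrite lt_def h1 andbT; apply/eqP => h0; move: h3; rewrite h0 mul0r ltxx.
by split => //; rewrite pmulr_rgt0 in h3.
Qed.

Section OpenSets.
Variable T : topologicalType.

Lemma open_gt0 (r : T -> R) : (forall x, 0 < r x -> cvgR (nbhs x) r (r x)) ->
  open [set x | 0 < r x].
Proof.
move=> h; rewrite openE => x hx; exact: (cvgR_gt0 _ (h x hx) hx).
Qed.

End OpenSets.

Section Chart.
Variables p1 p2 p3 : R[i].
Hypotheses (d1 : nsq p1 < 1) (d2 : nsq p2 < 1) (d3 : nsq p3 < 1).

Local Notation X := (X p1 p2 p3).
Local Notation Q := (Q p1 p2 p3).

(** ** Charts away from the branch points *)

(** The Cayley transform sends the disc minus the boundary point lam to the closed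
    upper half-plane, and the unit circle to the real axis. *)
Definition cayley (lam z : R[i]) : R[i] := 'i * (lam + z) / (lam - z).
Definition cayley_inv (lam u : R[i]) : R[i] := lam * (u - 'i) / (u + 'i).

Variables (lam y0 : R[i]).
Hypotheses (lam1 : nsq lam = 1) (y00 : y0 != 0).

(** A sheet is singled out by an angle of width pi/3 around y0: there the cube root
    y of Q z is y0 crt (Q z / y0^3). *)
Definition zdom : set (Cplx R * Cplx R) :=
  [set w | X w /\ (w.1 : R[i]) != lam /\ opensec ((w.2 : R[i]) / y0)].

Definition zopen : set (Cplx R) :=
  [set u | (u : R[i]) + 'i != 0 /\ 0 < Re (Q (cayley_inv lam u) / y0 ^+ 3)].

Definition zimg : set (Cplx R) := [set u | 0 <= Im (u : R[i]) /\ zopen u].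

Definition zphi (w : Cplx R * Cplx R) : R[i] := cayley lam w.1.

Definition zpsi (u : Cplx R) : Cplx R * Cplx R :=
  (cayley_inv lam u, y0 * crt (Q (cayley_inv lam u) / y0 ^+ 3)).

Definition zchart := cchart zdom zimg zphi zpsi.

Lemma i_neq0 : 'i != 0 :> R[i].
Proof. by rewrite eq_complex /= negb_and oner_eq0 orbT. Qed.

Lemma lam0 : lam != 0. Proof. by rewrite -nsq_gt0 lam1. Qed.

Lemma cayleyK z : z != lam -> cayley lam z + 'i != 0 /\
  cayley_inv lam (cayley lam z) = z.
Proof.
move=> hz; have h : lam - z != 0 by rewrite subr_eq0 eq_sym.
have e : cayley lam z + 'i = 2 * 'i * lam / (lam - z) by rewrite /cayley; field.
have e2 : cayley lam z - 'i = 2 * 'i * z / (lam - z) by rewrite /cayley; field.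
have n2 : (2 : R[i]) != 0 by rewrite pnatr_eq0.
split; first by rewrite e !mulf_neq0 ?invr_neq0 ?i_neq0 ?lam0.
rewrite /cayley_inv e e2; have := lam0; have := i_neq0; move=> h1 h2; field.
by rewrite h h1 h2.
Qed.

Lemma cayley_invK u : u + 'i != 0 -> cayley_inv lam u != lam /\
  cayley lam (cayley_inv lam u) = u.
Proof.
move=> hu; have l0 := lam0; have i0 := i_neq0.
have n2 : (2 : R[i]) != 0 by rewrite pnatr_eq0.
have e : lam - cayley_inv lam u = 2 * 'i * lam / (u + 'i) by rewrite /cayley_inv; field.
have e2 : lam + cayley_inv lam u = 2 * u * lam / (u + 'i) by rewrite /cayley_inv; field.
have h : lam - cayley_inv lam u != 0 by rewrite e !mulf_neq0 ?invr_neq0.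
split; first by rewrite eq_sym -subr_eq0.
by rewrite /cayley e e2; field; rewrite l0 i0 hu.
Qed.

Lemma cayley_Im z : z != lam -> Im (cayley lam z) = (1 - nsq z) / nsq (lam - z).
Proof.
move=> hz; have h : lam - z != 0 by rewrite subr_eq0 eq_sym.
have -> : cayley lam z = 'i * (lam + z) * (lam - z)^* * ((nsq (lam - z))^-1)%:C.
  rewrite /cayley -!mulrA; congr (_ * (_ * _)).
  rewrite fmorphV /= nsqE invfM mulrCA mulfV ?mulr1 ?conjc_eq0 //.
rewrite ImM /= mulr0 add0r -lam1; congr (_ * _).
by rewrite /nsq !ReImE /=; ring.
Qed.

Lemma cayley_inv_disc u : 0 <= Im u -> nsq (cayley_inv lam u) <= 1.
Proof.
move=> hu; have h : u + 'i != 0.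
  apply/eqP => h0; have := congr1 (@complex.Im _) h0; rewrite ImD /=; lra.
rewrite -(@ler_pM2r _ (nsq (u + 'i))) ?nsq_gt0 // -nsqM divfK // nsqM lam1 !mul1r.
rewrite /nsq !ReImE /=; lra.
Qed.

Lemma zdom_open : rel_open X zdom.
Proof.
exists ([set w | 0 < nsq ((w.1 : R[i]) - lam)] `&` ([set w | 0 < Re ((w.2 : R[i]) / y0)] `&`
  [set w | 0 < Re ((w.2 : R[i]) / y0) * Re ((w.2 : R[i]) / y0) -
    3 * (Im ((w.2 : R[i]) / y0) * Im ((w.2 : R[i]) / y0))])).
  have h1 (w : Cplx R * Cplx R) : cvgC (nbhs w) (fun w => (w.1 : R[i]) - lam) ((w.1 : R[i]) - lam).
    by apply: cvgC_sub; [exact: cvgC_fst|exact: cvgC_cst].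
  have h2 (w : Cplx R * Cplx R) : cvgC (nbhs w) (fun w => (w.2 : R[i]) / y0) ((w.2 : R[i]) / y0).
    by apply: cvgC_mul; [exact: cvgC_snd|exact: cvgC_cst].
  apply: openI; first by apply: open_gt0 => w _; apply: cvgC_nsq; exact: h1.
  apply: openI; first by apply: open_gt0 => w _; apply: cvgC_Re; exact: h2.
  apply: open_gt0 => w _; apply: cvgR_sub.
    by apply: cvgR_mul; apply: cvgC_Re; exact: h2.
  apply: cvgR_mul; first exact: cvgR_cst.
  by apply: cvgR_mul; apply: cvgC_Im; exact: h2.
apply/seteqP; split=> w.
  by move=> [h1 [h2 [h3 h4]]]; split=> //; rewrite /= nsq_gt0 subr_eq0.
by move=> [h1 [/= h2 [h3 h4]]]; split=> //; rewrite nsq_gt0 subr_eq0 in h2.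
Qed.

Lemma cvgC_cayley_inv (u : R[i]) : u + 'i != 0 ->
  cvgC (nbhs (u : Cplx R)) (cayley_inv lam) (cayley_inv lam u).
Proof.
have hid : cvgC (nbhs (u : Cplx R)) (fun v : R[i] => v) u by exact: cvg_id.
move=> hu; apply: cvgC_mul; first apply: cvgC_mul; first exact: cvgC_cst.
  by apply: cvgC_sub; [exact: hid|exact: cvgC_cst].
by apply: (cvgC_inv _ hu); apply: cvgC_add; [exact: hid|exact: cvgC_cst].
Qed.

Lemma cvgC_Q (T : Type) (F : set_system T) (FF : Filter F) f a :
  cvgC F f a -> cvgC F (fun x => Q (f x)) (Q a).
Proof.
move=> h; have aux p : cvgC F (fun x => f x - p) (a - p).
  by apply: cvgC_sub; [exact: h|exact: cvgC_cst].
by apply: cvgC_mul; [apply: cvgC_mul|]; exact: aux.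
Qed.

Lemma cvgC_zroot (u : R[i]) : u + 'i != 0 ->
  cvgC (nbhs (u : Cplx R)) (fun v => Q (cayley_inv lam v) / y0 ^+ 3)
    (Q (cayley_inv lam u) / y0 ^+ 3).
Proof.
move=> hu; apply: cvgC_mul; last exact: cvgC_cst.
by apply: cvgC_Q; exact: cvgC_cayley_inv.
Qed.

Lemma zopen_open : open zopen.
Proof.
rewrite openE => u [h1 h2].
have k1 : cvgC (nbhs (u : Cplx R)) (fun v : R[i] => v + 'i) ((u : R[i]) + 'i).
  by apply: cvgC_add; [exact: cvg_id|exact: cvgC_cst].
have k2 : cvgR (nbhs u) (fun v => Re (Q (cayley_inv lam v) / y0 ^+ 3))
    (Re (Q (cayley_inv lam u) / y0 ^+ 3)) by apply: cvgC_Re; exact: cvgC_zroot.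
exact: filterI (cvgC_neq0 _ k1 h1) (cvgR_gt0 _ k2 h2).
Qed.

Lemma zchart_chart : chart_of X zchart.
Proof.
have y3 : y0 ^+ 3 != 0 by rewrite expf_neq0.
apply: (cchart_of zdom_open zopen_open) => //.
- move=> [z y] [/coverE[/= hz hy] [/= h1 /opensecP[h2 h3]]].
  have [k1 k2] := cayleyK h1.
  split; first by rewrite /zphi /= cayley_Im // divr_ge0 ?nsq_ge0 // subr_ge0.
  by split => //=; rewrite /zphi /= k2 -hy -expr_div_n.
- move=> u [h1 [h2 h3]]; have [k1 k2] := cayley_invK h2.
  split; [apply/coverE; split => /=|split => //=].
  + exact: cayley_inv_disc.
  + by rewrite exprMn crtK mulrCA mulfV // mulr1.
  + rewrite mulrAC mulfV // mul1r; apply/opensecP; rewrite crtK; split => //.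
    by apply: crt_narrow; exact: ltW.
- move=> [z y] [/coverE[/= hz hy] [/= h1 /opensecP[h2 h3]]].
  have [k1 k2] := cayleyK h1.
  rewrite /zpsi /zphi /= k2 -hy -expr_div_n crt_cube //; last exact: ltW.
  by rewrite mulrCA mulfV // mulr1.
- by move=> u [h1 [h2 h3]]; have [k1 k2] := cayley_invK h2.
- move=> w [_ [h1 _]]; apply: cvgC_within.
  have l0 : lam - w.1 != 0 by rewrite subr_eq0 eq_sym.
  apply: cvgC_mul.
    apply: cvgC_mul; first exact: cvgC_cst.
    by apply: cvgC_add; [exact: cvgC_cst|exact: cvgC_fst].
  by apply: (cvgC_inv _ l0); apply: cvgC_sub; [exact: cvgC_cst|exact: cvgC_fst].
- apply: contC_within2 => u [h1 [h2 h3]].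
    by apply: cvgC_within; exact: cvgC_cayley_inv.
  apply: cvgC_mul; first exact: cvgC_cst.
  apply: cvgC_crt; first exact: ltW.
    have : \forall v \near within zimg (nbhs u), zimg v by exact: withinT.
    by apply: filterS => v [_ [_ hv]]; exact: ltW.
  by apply: cvgC_within; exact: cvgC_zroot.
Qed.

Lemma zchart_zcoord : zcoord zdom zphi.
Proof.
move=> x0 [_ [h0 _]] _.
have l0 := lam0; have i0 := i_neq0.
have n2 : (2 : R[i]) != 0 by rewrite pnatr_eq0.
have n0 : lam - x0.1 != 0 by rewrite subr_eq0 eq_sym.
exists (fun x => (lam - x.1) * ((lam - x0.1) / (2 * 'i * lam))); split.
- by rewrite !mulf_neq0 // invr_neq0 // !mulf_neq0.
- apply: cvgC_within; apply: cvgC_mul; last exact: cvgC_cst.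
  by apply: cvgC_sub; [exact: cvgC_cst|exact: cvgC_fst].
- move=> x [_ [h _]]; have n : lam - x.1 != 0 by rewrite subr_eq0 eq_sym.
  rewrite /zphi /cayley; field.
  by rewrite l0 i0 n n0.
Qed.

Lemma zdom_y w : zdom w -> w.2 != 0.
Proof.
move=> [_ [_ [h _]]]; apply/eqP => h0; move: h; rewrite h0 mul0r Re0 ltxx //.
Qed.

Lemma zchart_boundary w : zdom w -> (Im (zphi w) = 0) <-> (nsq (w.1 : R[i]) = 1).
Proof.
move=> [_ [h _]]; rewrite /zphi cayley_Im //.
have n : nsq (lam - w.1) != 0 by rewrite nsq_eq0 subr_eq0 eq_sym.
split=> [/eqP|->]; last by rewrite subrr mul0r.
by rewrite mulf_eq0 invr_eq0 (negPf n) orbF subr_eq0 => /eqP.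
Qed.

End Chart.

End Atlas.

(** ** Charts at the branch points *)

Section BranchChart.
Variable R : realType.
Variables p q s : R[i].
Hypotheses (dp : nsq p < 1) (dq : nsq q < 1) (ds : nsq s < 1).
Hypotheses (npq : p != q) (nps : p != s).

Local Notation X := (X p q s).
Local Notation Q := (Q p q s).

Definition cofac (z : R[i]) := (z - q) * (z - s).

Lemma cofac_neq0 : cofac p != 0.
Proof. by rewrite mulf_neq0 // subr_eq0. Qed.

Lemma QE z : Q z = (z - p) * cofac z.
Proof. by rewrite /Q /cofac mulrA. Qed.

Definition broot := xget 0 [set k : R[i] | k ^+ 3 = cofac p].

Lemma brootE : broot ^+ 3 = cofac p.
Proof.
rewrite /broot; case: xgetP => [k -> //|h].
by have [k hk] := cube_root_exists (cofac p); case: (h k).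
Qed.

(** A cube root of the cofactor near p, by which y is divided to obtain a cube root of
    z - p: this is a local coordinate at the branch point, whose inverse is explicit. *)
Definition bfac (z : R[i]) := broot * crt (cofac z / cofac p).

Definition bregion (z : R[i]) := 0 < 1 - nsq z /\ 0 < Re (cofac z / cofac p).

Lemma bfac_cube z : bfac z ^+ 3 = cofac z.
Proof. by rewrite exprMn brootE crtK mulrCA mulfV ?cofac_neq0 // mulr1. Qed.

Lemma bregion_cofac z : bregion z -> cofac z != 0.
Proof. by move=> [_ h]; apply/eqP => h0; rewrite h0 mul0r Re0 ltxx in h. Qed.

Lemma bfac_neq0 z : bregion z -> bfac z != 0.
Proof. by move=> /bregion_cofac; rewrite -bfac_cube expf_eq0. Qed.

Definition bdom : set (Cplx R * Cplx R) := [set w | X w /\ bregion w.1].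

(** The cube root v of z - p satisfies |v| < 2, so that the shift by 2i brings it into the
    open upper half-plane. *)
Definition bz (u : R[i]) := p + (u - 2 * 'i) ^+ 3.

Definition bopen : set (Cplx R) := [set u | bregion (bz u)].

Definition bimg : set (Cplx R) := [set u | 0 <= Im (u : R[i]) /\ bopen u].

Definition bphi (w : Cplx R * Cplx R) : R[i] := (w.2 : R[i]) / bfac w.1 + 2 * 'i.

Definition bpsi (u : Cplx R) : Cplx R * Cplx R :=
  (bz u, ((u : R[i]) - 2 * 'i) * bfac (bz u)).

Definition bchart := cchart bdom bimg bphi bpsi.

Lemma cvgC_cofac (T : Type) (F : set_system T) (FF : Filter F) f a :
  cvgC F f a -> cvgC F (fun x => cofac (f x)) (cofac a).
Proof.
move=> h; have aux c : cvgC F (fun x => f x - c) (a - c).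
  by apply: cvgC_sub; [exact: h|exact: cvgC_cst].
by apply: cvgC_mul; exact: aux.
Qed.

Lemma bregion_near (T : Type) (F : set_system T) (FF : Filter F) f a :
  cvgC F f a -> bregion a -> \forall x \near F, bregion (f x).
Proof.
move=> h [h1 h2].
have k1 : cvgR F (fun x => 1 - nsq (f x)) (1 - nsq a).
  by apply: cvgR_sub; [exact: cvgR_cst|apply: cvgC_nsq; exact: h].
have k2 : cvgR F (fun x => Re (cofac (f x) / cofac p)) (Re (cofac a / cofac p)).
  by apply: cvgC_Re; apply: cvgC_mul; [apply: cvgC_cofac; exact: h|exact: cvgC_cst].
exact: filterI (cvgR_gt0 _ k1 h1) (cvgR_gt0 _ k2 h2).
Qed.

Lemma cvgC_bfac (T : Type) (F : set_system T) (FF : Filter F) f a :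
  cvgC F f a -> bregion a -> cvgC F (fun x => bfac (f x)) (bfac a).
Proof.
move=> h ha; apply: cvgC_mul; first exact: cvgC_cst.
apply: cvgC_crt; first by case: ha => _ /ltW.
  by have := bregion_near FF h ha; apply: filterS => x [_ /ltW].
by apply: cvgC_mul; [apply: cvgC_cofac; exact: h|exact: cvgC_cst].
Qed.

Lemma bdom_open : rel_open X bdom.
Proof.
exists [set w : Cplx R * Cplx R | bregion w.1]; last by [].
rewrite openE => w hw.
have : \forall x \near nbhs w, bregion (x.1 : R[i]).
  by apply: bregion_near hw; exact: cvgC_fst.
by [].
Qed.

Lemma cvgC_bz (u : R[i]) : cvgC (nbhs (u : Cplx R)) bz (bz u).
Proof.
apply: cvgC_add; first exact: cvgC_cst.
by apply: cvgC_exp; apply: cvgC_sub; [exact: cvg_id|exact: cvgC_cst].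
Qed.

Lemma bopen_open : open bopen.
Proof.
rewrite openE => u hu.
have : \forall x \near nbhs u, bregion (bz x).
  by apply: bregion_near hu; exact: cvgC_bz.
by [].
Qed.

Lemma bdom_cube w : bdom w -> (w.2 / bfac w.1) ^+ 3 = (w.1 : R[i]) - p.
Proof.
move=> [/coverE[_ h1] h2].
by rewrite expr_div_n bfac_cube h1 QE mulfK // bregion_cofac.
Qed.

Lemma bphi_Im w : bdom w -> 0 < Im (bphi w).
Proof.
move=> hw; have h := bdom_cube hw; have [_ [hz _]] := hw.
set v := w.2 / bfac w.1 in h.
(* |v|^6 = |z - p|^2 is at most 4, hence less than 4^3. *)
have hv : nsq v < 4.
  rewrite -(@ltr_pXn2r _ 3) ?nnegrE ?nsq_ge0 // -nsqX h.
  apply: le_lt_trans (factor_bound dp _) _; first by rewrite ltW // -subr_gt0.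
  by rewrite !exprS expr0; lra.
have e2 : Im (2 * 'i : R[i]) = 2 by rewrite ImM Ren Imn /=; ring.
rewrite /bphi -/v ImD e2.
have := sqr_ge0 (Re v); move: hv; rewrite /nsq; nra.
Qed.

Lemma bz_bphi w : bdom w -> bz (bphi w) = w.1.
Proof. by move=> hw; rewrite /bz /bphi addrK bdom_cube // addrC subrK. Qed.

Lemma bchart_chart : chart_of X bchart.
Proof.
apply: (cchart_of bdom_open bopen_open) => //.
- move=> w hw; split; first by rewrite ltW // bphi_Im.
  by rewrite /bopen /= bz_bphi //; case: hw.
- move=> u [h1 h2]; split; last exact: h2.
  apply/coverE; split; first by case: h2 => h _; rewrite ltW // -subr_gt0.
  by rewrite /= exprMn bfac_cube QE /bz addrAC subrr add0r.
- move=> [z y] hw; rewrite /bpsi bz_bphi //= /bphi /= addrK divfK //.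
  by apply: bfac_neq0; case: hw.
- move=> u [h1 h2]; rewrite /bphi /= mulfK ?subrK //; exact: bfac_neq0.
- move=> w [_ hw]; apply: cvgC_within; apply: cvgC_add; last exact: cvgC_cst.
  apply: cvgC_mul; first exact: cvgC_snd.
  apply: (cvgC_inv _ (bfac_neq0 hw)); apply: cvgC_bfac hw; exact: cvgC_fst.
- apply: contC_within2 => u [h1 h2].
    by apply: cvgC_within; exact: cvgC_bz.
  apply: cvgC_within; apply: cvgC_mul.
    by apply: cvgC_sub; [exact: cvg_id|exact: cvgC_cst].
  by apply: cvgC_bfac h2; exact: cvgC_bz.
Qed.

Lemma bchart_zcoord : zcoord bdom bphi.
Proof.
move=> x0 hx0 y0; have [_ r0] := hx0.
pose v (x : Cplx R * Cplx R) : R[i] := x.2 / bfac x.1.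
have v0 : v x0 != 0 by rewrite mulf_neq0 // invr_neq0 // bfac_neq0.
have cv : cvgC (within bdom (nbhs x0)) v (v x0).
  apply: cvgC_within; apply: cvgC_mul; first exact: cvgC_snd.
  by apply: (cvgC_inv _ (bfac_neq0 r0)); apply: cvgC_bfac r0; exact: cvgC_fst.
exists (fun x => v x * v x + v x * v x0 + v x0 * v x0); split.
- have -> : v x0 * v x0 + v x0 * v x0 + v x0 * v x0 = 3 * v x0 * v x0 by ring.
  apply: mulf_neq0; last exact: v0.
  by apply: mulf_neq0; [rewrite pnatr_eq0|exact: v0].
- apply: cvgC_add; last exact: cvgC_cst.
  apply: cvgC_add; apply: cvgC_mul; try exact: cv.
  exact: cvgC_cst.
- move=> x hx; rewrite /bphi -/(v x) -/(v x0).
  transitivity (v x ^+ 3 - v x0 ^+ 3); last by ring.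
  by rewrite !bdom_cube //; ring.
Qed.

Lemma bdom_branch w : bdom w -> w.2 = 0 -> w.1 = p.
Proof.
move=> hw h0; have := bdom_cube hw; rewrite h0 mul0r expr0n /= => /esym/eqP.
by rewrite subr_eq0 => /eqP.
Qed.

Lemma bdom_center : bdom (p, 0).
Proof.
split; first by apply/coverE; split; [exact: ltW|rewrite QE subrr mul0r expr0n].
by split; rewrite /= ?subr_gt0 // mulfV ?cofac_neq0 // Re1.
Qed.

End BranchChart.

(** * The covering is a torus with three boundary circles *)

Section Main.
Variable R : realType.

Lemma Q_rot (p q s z : R[i]) : Q q s p z = Q p q s z.
Proof. by rewrite /Q; ring. Qed.

Lemma X_rot (p q s : R[i]) : X q s p = X p q s.
Proof.
apply/seteqP; split=> w /coverE[h1 h2]; apply/coverE; split=> //; rewrite h2.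
  by rewrite [LHS]Q_rot.
by rewrite [RHS]Q_rot.
Qed.

Variables p1 p2 p3 : R[i].
Hypotheses (d1 : nsq p1 < 1) (d2 : nsq p2 < 1) (d3 : nsq p3 < 1).
Hypotheses (n12 : p1 != p2) (n13 : p1 != p3) (n23 : p2 != p3).

Local Notation X := (X p1 p2 p3).

Definition is_zchart (c : chart R (Cplx R * Cplx R)%type) := exists lam y0 : R[i],
  [/\ nsq lam = 1, y0 != 0 & c = zchart p1 p2 p3 lam y0].

Definition is_bchart (c : chart R (Cplx R * Cplx R)%type) :=
  [\/ c = bchart p1 p2 p3, c = bchart p2 p3 p1 | c = bchart p3 p1 p2].

Definition atlas : set (chart R (Cplx R * Cplx R)%type) :=
  [set c | is_zchart c \/ is_bchart c].

Lemma atlas_chart c : atlas c -> chart_of X c.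
Proof.
have n21 : p2 != p1 by rewrite eq_sym.
have n31 : p3 != p1 by rewrite eq_sym.
have n32 : p3 != p2 by rewrite eq_sym.
case=> [[lam [y0 [h1 h2 ->]]]|[] ->].
- exact: zchart_chart.
- exact: bchart_chart.
- by rewrite -X_rot; exact: bchart_chart.
- by rewrite -X_rot -X_rot; exact: bchart_chart.
Qed.

Lemma unit_pole (z : R[i]) : exists2 lam : R[i], nsq lam = 1 & z != lam.
Proof.
have [->|h] := eqVneq z 1.
  exists (-1); first by rewrite nsqN /nsq Re1 Im1 expr1n expr0n addr0.
  by rewrite eq_complex /=; apply/negP => /andP[/eqP]; lra.
by exists 1 => //; rewrite /nsq Re1 Im1 expr1n expr0n addr0.
Qed.

Lemma zchart_cover (w : Cplx R * Cplx R) : X w -> w.2 != 0 -> exists lam y0 : R[i],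
  [/\ nsq lam = 1, y0 != 0 & zdom p1 p2 p3 lam y0 w].
Proof.
move=> Xw y0; have [lam h1 h2] := unit_pole w.1.
exists lam, w.2; split => //; split => //; split => //.
by rewrite mulfV // /opensec Re1 Im1; split; lra.
Qed.

Lemma atlas_cover x : X x -> exists2 c, atlas c & chart_dom c x.
Proof.
case: x => z t Xx; have [y0|y0] := eqVneq t 0; last first.
  have [lam [y [h1 h2 h3]]] := zchart_cover Xx y0.
  by exists (zchart p1 p2 p3 lam y) => //; left; exists lam, y.
have n21 : p2 != p1 by rewrite eq_sym.
have n31 : p3 != p1 by rewrite eq_sym.
have n32 : p3 != p2 by rewrite eq_sym.
move: Xx => /coverE[_] /=; rewrite y0 expr0n /= => /esym/eqP.
rewrite !mulf_eq0 !subr_eq0 -orbA => /or3P[] /eqP ->.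
- exists (bchart p1 p2 p3); first by right; apply: Or31.
  exact: bdom_center.
- exists (bchart p2 p3 p1); first by right; apply: Or32.
  exact: bdom_center.
- exists (bchart p3 p1 p2); first by right; apply: Or33.
  exact: bdom_center.
Qed.

Lemma n21 : p2 != p1. Proof. by rewrite eq_sym. Qed.
Lemma n31 : p3 != p1. Proof. by rewrite eq_sym. Qed.
Lemma n32 : p3 != p2. Proof. by rewrite eq_sym. Qed.

(** While zcoord says nothing at a branch point, the only transition map there is that of
    a chart with itself. *)
Lemma branch_chart_unique c c' x : atlas c -> atlas c' ->
  chart_dom c x -> chart_dom c' x -> x.2 = 0 -> c = c'.
Proof.
have hz d : is_zchart d -> chart_dom d x -> x.2 = 0 -> False.
  by move=> [lam [y0 [h1 h2 ->]]] /zdom_y/eqP.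
have b1 := @bdom_branch R p1 p2 p3 n12 n13 x.
have b2 := @bdom_branch R p2 p3 p1 n23 n21 x.
have b3 := @bdom_branch R p3 p1 p2 n31 n32 x.
case=> [/hz h _ /h h1 _ /h1 //|hc]; case=> [/hz h _ /h h1 /h1 //|hc'].
case: hc hc' => -> [] -> //= h1 h2 h0; exfalso; move: h1 h2.
- by move=> /b1/(_ h0) e1 /b2/(_ h0) e2; move: n12; rewrite -e1 -e2 eqxx.
- by move=> /b1/(_ h0) e1 /b3/(_ h0) e2; move: n13; rewrite -e1 -e2 eqxx.
- by move=> /b2/(_ h0) e1 /b1/(_ h0) e2; move: n12; rewrite -e1 -e2 eqxx.
- by move=> /b2/(_ h0) e1 /b3/(_ h0) e2; move: n23; rewrite -e1 -e2 eqxx.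
- by move=> /b3/(_ h0) e1 /b1/(_ h0) e2; move: n13; rewrite -e1 -e2 eqxx.
- by move=> /b3/(_ h0) e1 /b2/(_ h0) e2; move: n23; rewrite -e1 -e2 eqxx.
Qed.

Lemma atlas_zcoord c : atlas c -> exists D I phi psi,
  c = cchart D I phi psi /\ zcoord D phi.
Proof.
case=> [[lam [y0 [h1 h2 ->]]]|[] ->].
- by do 4!eexists; split; first by []; exact: zchart_zcoord.
- by do 4!eexists; split; first by []; exact: (bchart_zcoord n12 n13).
- by do 4!eexists; split; first by []; exact: (bchart_zcoord n23 n21).
- by do 4!eexists; split; first by []; exact: (bchart_zcoord n31 n32).
Qed.

Lemma oriented : oriented_atlas X atlas.
Proof.
split; [exact: atlas_chart|exact: atlas_cover|].
move=> c c' hc hc' _ [x0 [hx hx'] <-].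
have cc := atlas_chart hc.
have [D [I [phi [psi [ec zc]]]]] := atlas_zcoord hc.
have [y0|y0] := eqVneq x0.2 0.
  have e := branch_chart_unique hc hc' hx hx' y0; rewrite -e ec in hx cc *.
  refine (@cchart_transition R _ X D I phi psi D I phi psi x0 1 cc hx hx _ _).
    exact: oner_neq0.
  move=> eps e0.
  by apply: filterE => x; rewrite mul1r subrr cmod0 mulr_ge0 ?cmod_ge0 // ltW.
have [D' [I' [phi' [psi' [ec' zc']]]]] := atlas_zcoord hc'.
rewrite ec ec' in hx hx' cc *.
have [d d0 hd] := zcoord_transition zc zc' hx hx' y0.
exact (@cchart_transition R _ X D I phi psi D' I' phi' psi' x0 d cc hx hx' d0 hd).
Qed.

Lemma boundary_rim : atlas_boundary atlas = \bigcup_(j in [set: 'I_3]) rim p1 p2 p3 j.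
Proof.
have hb (p q s : R[i]) w : nsq p < 1 -> p != q -> p != s -> bdom p q s w ->
    toV (bphi p q s w) 0 1 <> 0.
  by move=> hp k1 k2 /(bphi_Im hp k1 k2) h; rewrite mxE /= => h0; rewrite h0 ltxx in h.
have hy (w : Cplx R * Cplx R) : X w -> nsq (w.1 : R[i]) = 1 -> w.2 != 0.
  move=> /coverE[_ h] h1; apply/eqP => h0; move: h; rewrite h0 expr0n /= => /esym/eqP.
  rewrite !mulf_eq0 !subr_eq0 -orbA => /or3P[] /eqP e; move: h1; rewrite e => e1.
  - by move: d1; rewrite e1 ltxx.
  - by move: d2; rewrite e1 ltxx.
  - by move: d3; rewrite e1 ltxx.
apply/seteqP; split=> w.
  move=> [c hc [+ +]]; case: hc => [[lam [y0 [h1 h2 ->]]]|[] ->] /=.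
  - move=> hw; rewrite mxE /= => /(zchart_boundary h1 hw) h3.
    by have [j hj] := @rim_cover R p1 p2 p3 w hw.1 h3; exists j.
  - by move=> /(hb _ _ _ _ d1 n12 n13) h /h.
  - by move=> /(hb _ _ _ _ d2 n23 n21) h /h.
  - by move=> /(hb _ _ _ _ d3 n31 n32) h /h.
move=> [j _ hj]; have Xw := rim_X hj; have [h1 _] := hj.
have [lam [y0 [k1 k2 k3]]] := zchart_cover Xw (hy w Xw h1).
exists (zchart p1 p2 p3 lam y0); first by left; exists lam, y0.
by split => //=; rewrite mxE /=; apply/(zchart_boundary k1 k3).
Qed.

Lemma cover_torus : torus_with_boundary R 3 X.
Proof.
split; first exact: compact_X.
- exact: connected_X.
- exact: hausdorff_X.
- exists atlas, (rim p1 p2 p3); split; first exact: oriented.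
  + by split; [exact: rim_homeo|exact: rim_disjoint|exact: boundary_rim].
  + exact: X_capped_off.
Qed.

End Main.

Theorem lemma2p1 (R : realType) (p1 p2 p3 : Cplx R)
    (h1 : `|p1| < 1) (h2 : `|p2| < 1) (h3 : `|p3| < 1)
    (h12 : p1 <> p2) (h13 : p1 <> p3) (h23 : p2 <> p3) :
  torus_with_boundary R 3 (cyclic_cover3 [:: p1; p2; p3]).
Proof.
by apply: cover_torus; rewrite -?normC_lt1 //; apply/eqP.
Qed.
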